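(* Let $n\ge 1$ and $r\ge 2$ be integers, $W=S_r$, $P=\mathbb{Z}^r$, $P^+=\{\lambda\in P:\lambda_1\ge\dots\ge\lambda_r\}$, $\rho_{GL}=(r-1,r-2,\dots,0)$, and set $v=q^2$ (so $q=v^{1/2}$). Let $\theta\in(\mathbb{Z}/n\mathbb{Z})^r$ and let $\mu\in P$ with $\mu-\rho_{GL}\in P^+$. Then $\mathbf{y}^{\rho_{GL}-\lfloor\theta\rfloor_n}\,\tilde\phi^o_\theta(\mathbf{y};\varpi^{\rho_{GL}-\mu};v)$ is a (Laurent) polynomial in $\mathbf{y}^n=(y_1^n,\dots,y_r^n)$. It vanishes unless $\mu \bmod n$ is a permutation of $\theta$, and in this case \begin{align*} w_0\Big(\mathbf{y}^{\frac{\rho_{GL}-\lfloor\theta\rfloor_n}{n}}\,\tilde\phi^o_\theta(\mathbf{y}^{1/n};\varpi^{\rho_{GL}-\mu};v)\Big)&=C\cdot\mathcal{T}_{w,v^{1/2}}\sum_{u\in W_{\mathbf{c}}}\mathcal{T}_{u,v^{1/2}}\,\mathcal{T}_{w',v^{1/2}}^{-1}\,\mathbf{y}^{\lambda+\rho_{GL}}\\ &=C'\cdot\mathbf{y}^{\rho_{GL}}\,\psi^{J_{\mathbf{c}}}_{w^{\mathbf{c}}}(\mathbf{y};\varpi^{-\lambda}w';v^{-1}), \end{align*} where $\lambda=\lfloor \mu/n\rfloor-\rho_{GL}$ (floor taken entrywise). Here $w,w'\in W$ and $\mathbf{c}$ is a (weakly) decreasing $r$-tuple of elements of $\{1,\dots,n\}$;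 these are determined uniquely by $-\mu=w'\mathbf{c} \bmod n$ and $-w_0\theta=w\mathbf{c}\bmod n$ together with $w',\,w_0w\in W^{\mathbf{c}}$. Further, $J_{\mathbf{c}}=\{1\le j\le r-1: c_j=c_{j+1}\}$, and \begin{align*} C&=\frac{(-1)^{l(w_0)}\,v^{\,l(w)/2-l(w')/2+l(w_0)/2+l(w_0(W_{\mathbf{c}}))}\,h^{m,\mathbf{c}}_v(w_0w)}{h^{m,\mathbf{c}}_v(w')},\\ C'&=v^{\,l(w')-l(w_{\mathbf{c}})}\,C . \end{align*}
   Context: Work over a field $\mathbb{F}$ (e.g. $\mathbb{C}$) containing a nonzero $v$ with a fixed square root $v^{1/2}$. General notation. For $\lambda\in\mathbb{Z}^r$, $\mathbf{y}^\lambda=y_1^{\lambda_1}\cdots y_r^{\lambda_r}$. $W=S_r$ acts on $\mathbb{Z}^r$ by permuting coordinates ($we_i=e_{w(i)}$) and on Laurent polynomials by $w\mathbf{y}^\lambda=\mathbf{y}^{w\lambda}$; $s_i=(i\ i{+}1)$; $l$ is the length and $w_0$ the longest element. $\iota$ is the linear map $\mathbf{y}^\lambda\mapsto\mathbf{y}^{-\lambda}$. For $\theta\in(\mathbb{Z}/n)^r$, $\lfloor\theta\rfloor_n\in\{0,\dots,n-1\}^r$ is the entrywise least nonnegative residue. Replacing $\mathbf{y}$ by $\mathbf{y}^{1/n}$ means replacing each $\mathbf{y}^{n\lambda}$ by $\mathbf{y}^\lambda$. $W_{\mathbf{c}}=\langle s_j:j\in J_{\mathbf{c}}\rangle$ is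 the stabilizer of $\mathbf{c}$ in $W$, $W^{\mathbf{c}}$ the set of minimal length representatives of $W/W_{\mathbf{c}}$, $w_0(W_{\mathbf c})$ the longest element of $W_{\mathbf c}$, and $w=w^{\mathbf{c}}w_{\mathbf{c}}$ with $w^{\mathbf{c}}\in W^{\mathbf{c}}$, $w_{\mathbf{c}}\in W_{\mathbf{c}}$. Parameters. $g_j\in\mathbb{F}^\times$ ($j\in\mathbb{Z}$) satisfy $g_j=-1$ if $n\mid j$, $g_{j+n}=g_j$, and $g_jg_{n-j}=v^{-1}$ if $n\nmid j$. For $w\in W$, $h^{m,\mathbf{c}}_v(w)=(-v^{1/2})^{l(w)}\prod_{i<j,\ w(i)>w(j)} g_{-(c_i-c_j)}$. Demazure-Whittaker operators (non-metaplectic). For $1\le i\le r-1$ and a Laurent polynomial $f$, with $\mathbf{y}^{\alpha_i^\vee}=y_i/y_{i+1}$, $$\mathcal{T}_{i,q}f=\frac{\mathbf{y}^{\alpha_i^\vee}-q^{-2}}{1-\mathbf{y}^{\alpha_i^\vee}}\,s_if+\frac{q^{-2}-1}{1-\mathbf{y}^{\alpha_i^\vee}}\,f,$$ and $\mathcal{T}_{w,q}=\mathcal{T}_{i_1,q}\cdots\mathcal{T}_{i_k,q}$ for a reduced expression $w=s_{i_1}\cdots s_{i_k}$. Metaplectic operators. For $\lambda\in\mathbb{Z}^r$ and $a=\lambda_i-\lambda_{i+1}$, let $r_n(a)\in\{0,\dots,n-1\}$ be the residue of $a$ mod $n$, and $$\pi^m_v(T_i)\mathbf{y}^\lambda=-v^{1/2}g_{-a}\,\mathbf{y}^{s_i\lambda}+(v^{1/2}-v^{-1/2})\,\frac{1-(y_i/y_{i+1})^{r_n(a)-a}}{1-(y_i/y_{i+1})^{n}}\,\mathbf{y}^\lambda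 .$$ These satisfy the braid relations and $(T_i-v^{1/2})(T_i+v^{-1/2})=0$. Set $\mathcal{T}^m_{i,v}=-v^{1/2}\,\mathbf{y}^{\rho_{GL}}\,\pi^m_v(T_i)^{-1}\,\mathbf{y}^{-\rho_{GL}}$ and $\mathcal{T}^m_{w,v}=\mathcal{T}^m_{i_1,v}\cdots\mathcal{T}^m_{i_k,v}$ for a reduced expression. Component metaplectic spherical Whittaker functions. $\tilde\phi^o_\theta=\sum_{w\in W}\phi_{\rho_{GL}-\lfloor\theta\rfloor_n,w}$ is a sum of metaplectic Iwahori-Whittaker functions for the $n$-fold cover of $GL_r$ over a non-archimedean local field with uniformizer $\varpi$ ($\varpi^\lambda$ is the diagonal matrix with entries $\varpi^{\lambda_i}$). Its known algebraic description, which may be taken as its definition here, is: $\tilde\phi^o_\theta(\mathbf{y};\varpi^{\rho_{GL}-\mu};v)$ is the component of the Laurent polynomial $\sum_{w\in W}\iota\,\mathcal{T}^m_{w,v}\,\iota\,\mathbf{y}^{\mu-\rho_{GL}}$ consisting of the terms with exponents in $\lfloor\theta\rfloor_n-\rho_{GL}+n\mathbb{Z}^r$. Parahoric Whittaker functions (non-metaplectic). For $J\subseteq\{1,\dots,r-1\}$, $W_J=\langle s_j:j\in J\rangle$, $w$ a minimal length representative in $W/W_J$, $w'\in W$ and $\lambda+\rho_{GL}\in P^+$, $\psi^J_w$ (a sum of Iwahori-Whittaker functions over $wW_J$) has the known description, which may be taken as its definition here, $$\psi^J_w(\mathbf{y};\varpi^{-\lambda}w';v)=v^{l(w')}\,\mathbf{y}^{-\rho_{GL}}\sum_{u\in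 W_J}\mathcal{T}_{wu,v^{-1/2}}\,\mathcal{T}_{w',v^{-1/2}}^{-1}\,\mathbf{y}^{\lambda+\rho_{GL}} .$$ *)

(* Defs.v *)
From Stdlib Require Import ClassicalEpsilon.
From HB Require Import structures.
From mathcomp Require Import all_boot all_order all_algebra all_fingroup.
From mathcomp Require Import finmap.
From mathcomp.multinomials Require Import monalg.

Set Implicit Arguments.
Unset Strict Implicit.
Unset Printing Implicit Defensive.

Import Order.TTheory GRing.Theory Num.Theory.
Local Open Scope ring_scope.

Notation weight r := {ffun 'I_r -> int}.

Definition rho (r : nat) : weight r := [ffun i : 'I_r => (r - i.+1)%N%:Z].

Definition decreasing r (lam : weight r) : Prop :=
  forall i j : 'I_r, (i <= j)%N -> lam j <= lam i.

Definition wcongr (n : nat) r (a b : weight r) : bool :=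
  [forall i, (a i == b i %[mod n%:Z])%Z].

Definition wfloor (n : nat) r (a : weight r) : weight r :=
  [ffun i => (a i %/ n%:Z)%Z].

(* (Z/n)^r is {ffun 'I_r -> 'I_n}: a class is given by its least nonnegative
   residue. This is correct for every n >= 1, unlike 'Z_n at n = 1. *)
Definition resid (n r : nat) (theta : {ffun 'I_r -> 'I_n}) : weight r :=
  [ffun i => (theta i)%:Z].

(* The product of W = S_r: permutations are composed as functions,
   (w u)(i) = w(u(i)), which is the opposite of the product of {perm _}. *)
Definition wmul r (w u : 'S_r) : 'S_r := (u * w)%g.

(* w e_i = e_{w(i)}, hence (w lam)_{w(i)} = lam_i. *)
Definition wact r (w : 'S_r) (lam : weight r) : weight r :=
  [ffun j => lam (w^-1%g j)].

(* Simple reflections and simple coroots are indexed by 'I_r.-1; with indices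
   starting from 0, i : 'I_r.-1 stands for the positions i and i.+1. *)
Lemma pos0_subproof r (i : 'I_r.-1) : (i < r)%N.
Proof. exact: leq_trans (ltn_ord i) (leq_pred r). Qed.

Lemma pos1_subproof r (i : 'I_r.-1) : (i.+1 < r)%N.
Proof. by rewrite -ltn_predRL. Qed.

Definition pos0 r (i : 'I_r.-1) : 'I_r := Ordinal (pos0_subproof i).
Definition pos1 r (i : 'I_r.-1) : 'I_r := Ordinal (pos1_subproof i).

Definition srefl r (i : 'I_r.-1) : 'S_r := tperm (pos0 i) (pos1 i).

Definition alpha r (i : 'I_r.-1) : weight r :=
  [ffun j => (j == pos0 i)%:Z - (j == pos1 i)%:Z].

Definition word_perm r (t : seq 'I_r.-1) : 'S_r :=
  foldr (fun i w => wmul (srefl i) w) 1%g t.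

Definition has_word r (w : 'S_r) (k : nat) : bool :=
  [exists t : k.-tuple 'I_r.-1, word_perm t == w].

Lemma word_perm_cat r (s t : seq 'I_r.-1) :
  word_perm (s ++ t) = wmul (word_perm s) (word_perm t).
Proof.
by elim: s => [|i s IH] /=; rewrite /wmul ?mulg1 // IH /wmul mulgA.
Qed.

Lemma word_ex_tperm r (k : nat) (i j : 'I_r) :
  j = (i + k)%N :> nat -> exists t, word_perm t = tperm i j.
Proof.
elim: k j => [|k IH] j Ej.
  exists [::]; rewrite addn0 in Ej.
  by rewrite (ord_inj Ej) tperm1.
have lti : (i + k < r.-1)%N by rewrite ltn_predRL -addnS -Ej ltn_ord.
pose m := Ordinal lti.
have Ej1 : pos1 m = j by apply: ord_inj; rewrite Ej addnS.
have [t Et] := IH (pos0 m) (erefl _).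
case: (posnP k) => [k0|k_gt0].
  exists [:: m]; rewrite /= /wmul mul1g /srefl Ej1; congr (tperm _ _).
  by apply: ord_inj => /=; rewrite k0 addn0.
exists (m :: t ++ [:: m]).
rewrite /= word_perm_cat Et /= /wmul mul1g.
have -> : (srefl m * tperm i (pos0 m) * srefl m)%g
        = (tperm i (pos0 m) ^ srefl m)%g by rewrite conjgE tpermV mulgA.
rewrite tpermJ /srefl tpermL Ej1 tpermD //; apply/eqP => /(congr1 val) /=.
  by move=> E; move: (ltnn i); rewrite -{2}E -addn1 leq_add2l k_gt0.
by move=> E; move: Ej => /eqP; rewrite E -{1}[nat_of_ord i]addn0 eqn_add2l.
Qed.

Lemma word_ex r (w : 'S_r) : exists k, has_word w k.
Proof.
suff [t Et] : exists t, word_perm t = w.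
  by exists (size t); apply/existsP; exists (in_tuple t); apply/eqP.
have [ts -> _] := prod_tpermP w.
elim: ts => [|[i j] ts [t Et]]; first by exists [::]; rewrite big_nil.
rewrite big_cons /=.
suff [u Eu] : exists u, word_perm u = tperm i j.
  by exists (t ++ u); rewrite word_perm_cat Et Eu.
have [le|lt] := leqP i j.
  by apply: (@word_ex_tperm _ (j - i)); rewrite subnKC.
by rewrite tpermC; apply: (@word_ex_tperm _ (i - j)); rewrite subnKC // ltnW.
Qed.

Definition len r (w : 'S_r) : nat := ex_minn (word_ex w).

Lemma redword_ex r (w : 'S_r) :
  exists t : (len w).-tuple 'I_r.-1, word_perm t == w.
Proof. by rewrite /len; case: ex_minnP => k /existsP. Qed.

Definition redword r (w : 'S_r) : seq 'I_r.-1 := xchoose (redword_ex w).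

(* W_c and W_J. *)
Definition wstab r (c : weight r) : {set 'S_r} := [set w | wact w c == c].
Definition wpara r (J : {set 'I_r.-1}) : {set 'S_r} :=
  <<[set srefl j | j in J]>>%g.

Definition Jset r (c : weight r) : {set 'I_r.-1} :=
  [set j | c (pos0 j) == c (pos1 j)].

(* Minimal length representatives of W/H. *)
Definition minrep r (H : {set 'S_r}) : {set 'S_r} :=
  [set w | [forall u in H, len w <= len (wmul w u)]%N].

Definition longest r (H : {set 'S_r}) : 'S_r :=
  [arg max_(w > 1%g in H) len w]%N.

(* Laurent polynomials, as the group algebra F[Z^r]. *)
Definition laurent (F : fieldType) (r : nat) : Type := {malg F[weight r]}.
HB.instance Definition _ (F : fieldType) r :=
  Choice.copy (laurent F r) {malg F[weight r]}.

(* The F-module structure is that of {malg F[weight r]}; its operations are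
   locked only to keep unification from unfolding them. *)
Fact laurent_key : unit. Proof. by []. Qed.

Section LaurentModule.
Variables (F : fieldType) (r : nat).
Let M : lmodType F := {malg F[weight r]}.

Definition lzero : laurent F r := locked_with laurent_key (0 : M).
Definition lopp : laurent F r -> laurent F r :=
  locked_with laurent_key (fun f : M => - f).
Definition ladd : laurent F r -> laurent F r -> laurent F r :=
  locked_with laurent_key (fun f g : M => f + g).
Definition lscale : F -> laurent F r -> laurent F r :=
  locked_with laurent_key (fun c (f : M) => c *: f).

Fact laddA : associative ladd.
Proof. by rewrite /ladd unlock; apply: (@addrA M). Qed.
Fact laddC : commutative ladd.
Proof. by rewrite /ladd unlock; apply: (@addrC M). Qed.
Fact ladd0f : left_id lzero ladd.
Proof. by rewrite /ladd /lzero !unlock; apply: (@add0r M). Qed.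
Fact laddNf : left_inverse lzero lopp ladd.
Proof. by rewrite /ladd /lzero /lopp !unlock; apply: (@addNr M). Qed.

HB.instance Definition _ :=
  GRing.isZmodule.Build (laurent F r) laddA laddC ladd0f laddNf.

Fact lscaleA (a b : F) (f : laurent F r) :
  lscale a (lscale b f) = lscale (a * b) f.
Proof. by rewrite /lscale !unlock; apply: (@scalerA F M). Qed.
Fact lscale1f : left_id 1 lscale.
Proof. by rewrite /lscale unlock; apply: (@scale1r F M). Qed.
Fact lscaleDr : right_distributive lscale +%R.
Proof.
by rewrite /lscale /GRing.add /= /ladd !unlock; apply: (@scalerDr F M).
Qed.
Fact lscaleDl (f : laurent F r) : {morph lscale^~ f : a b / a + b}.
Proof.
by rewrite /lscale {2}/GRing.add /= /ladd !unlock => a b;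
  apply: (@scalerDl F M).
Qed.

HB.instance Definition _ := GRing.Zmodule_isLmodule.Build F (laurent F r)
  lscaleA lscale1f lscaleDr lscaleDl.

Lemma lcoeff0 (a : weight r) : mcoeff a (0 : laurent F r) = 0.
Proof. by rewrite -[0 : laurent F r]/lzero /lzero unlock mcoeff0. Qed.

Lemma lcoeffP (c : F) (f g : laurent F r) (a : weight r) :
  mcoeff a (c *: f + g : laurent F r) = c * mcoeff a f + mcoeff a g.
Proof.
rewrite -[_ + _ : laurent F r]/(ladd (lscale c f) g) /ladd /lscale !unlock.
by rewrite (@mcoeffD _ F) mcoeffZ.
Qed.

End LaurentModule.

(* The monomial y^lam (locked for the same reason, as are lext and lmul). *)
Fact ypow_key : unit. Proof. by []. Qed.
Definition ypow (F : fieldType) r : weight r -> laurent F r :=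
  locked_with ypow_key (fun lam => mkmalgU lam 1).
Arguments ypow {F r} lam.

Lemma ypowE (F : fieldType) r (lam : weight r) :
  ypow lam = mkmalgU lam 1 :> laurent F r.
Proof. by rewrite /ypow unlock. Qed.

(* The F-linear map with y^lam |-> phi lam. *)
Fact lext_key : unit. Proof. by []. Qed.
Definition lext (F : fieldType) r (V : lmodType F) :
    (weight r -> V) -> laurent F r -> V :=
  locked_with lext_key
    (fun phi f => \sum_(lam <- msupp f) mcoeff lam f *: phi lam).

Lemma lextE (F : fieldType) r (V : lmodType F) (phi : weight r -> V)
    (f : laurent F r) :
  lext phi f = \sum_(lam <- msupp f) mcoeff lam f *: phi lam.
Proof. by rewrite /lext unlock. Qed.

Fact lmul_key : unit. Proof. by []. Qed.
Definition lmul (F : fieldType) r : laurent F r -> laurent F r -> laurent F r :=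
  locked_with lmul_key
    (fun f g => lext (fun a => lext (fun b => ypow (a + b)) g) f).

Lemma lmulE (F : fieldType) r (f g : laurent F r) :
  lmul f g = lext (fun a => lext (fun b => ypow (a + b)) g) f.
Proof. by rewrite /lmul unlock. Qed.

Section LaurentRing.
Variables (F : fieldType) (r : nat).
Implicit Types (f g h : laurent F r) (a b : weight r).

Lemma lextEw (V : lmodType F) (phi : weight r -> V) f (d : {fset weight r}) :
  fsubset (msupp f) d ->
  lext phi f = \sum_(lam <- d) mcoeff lam f *: phi lam.
Proof.
move=> le; rewrite lextE (big_fset_incl _ le) //= => x _ xf.
by rewrite mcoeff_outdom // scale0r.
Qed.

Lemma lext_is_linear (V : lmodType F) (phi : weight r -> V) :
  linear (lext phi).
Proof.
move=> c f g.
pose d := fsetU (msupp (c *: f + g)) (fsetU (msupp f) (msupp g)).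
have sf : fsubset (msupp f) d by rewrite /d fsetUCA fsubsetUl.
have sg : fsubset (msupp g) d by rewrite /d fsetUA fsubsetUr.
have sh : fsubset (msupp (c *: f + g)) d by rewrite fsubsetUl.
rewrite (lextEw _ sf) (lextEw _ sg) (lextEw _ sh) scaler_sumr -big_split /=.
by apply: eq_bigr => x _; rewrite lcoeffP scalerDl scalerA.
Qed.

HB.instance Definition _ (V : lmodType F) (phi : weight r -> V) :=
  GRing.isLinear.Build F (laurent F r) V *:%R (lext phi) (lext_is_linear phi).

Lemma lext_ypow (V : lmodType F) (phi : weight r -> V) a :
  lext phi (ypow a) = phi a.
Proof.
rewrite lextE ypowE msuppU oner_eq0 big_seq_fset1 mcoeffUU.
by rewrite scale1r.
Qed.

Lemma laurentE f : f = lext ypow f.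
Proof.
apply/malgP => k; rewrite lextE.
pose ck (h : laurent F r) : F := mcoeff k h.
have ck0 : ck 0 = 0 by apply: lcoeff0.
have ckD : {morph ck : x y / x + y}.
  by move=> x y; rewrite -[x in LHS]scale1r /ck lcoeffP mul1r.
rewrite -[RHS]/(ck _) (big_morph ck ckD ck0) [RHS]big_seq.
have ckZ x : ck (mcoeff x f *: ypow x) = mcoeff x f *+ (x == k).
  by rewrite -[_ *: _]addr0 /ck lcoeffP lcoeff0 addr0 ypowE mcoeffU mulr_natr.
under eq_bigr => x _ do rewrite ckZ.
rewrite -big_seq; case: (boolP (k \in msupp f)) => kf.
  rewrite (big_fsetD1 k) //= eqxx big_seq big1 ?addr0 // => x.
  by rewrite !inE => /andP[/negPf-> _].
rewrite mcoeff_outdom // big_seq big1 // => x xf.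
by case: eqP => // xk; rewrite -xk xf in kf.
Qed.

Lemma linear_ypow_eq (V : lmodType F) (A B : laurent F r -> V) :
  linear A -> linear B ->
  (forall a, A (ypow a) = B (ypow a)) -> forall f, A f = B f.
Proof.
move=> linA linB AB f.
pose HA := GRing.isLinear.Build F (laurent F r) V *:%R A linA.
pose HB := GRing.isLinear.Build F (laurent F r) V *:%R B linB.
pose A' : {linear laurent F r -> V} := HB.pack A HA.
pose B' : {linear laurent F r -> V} := HB.pack B HB.
rewrite -[LHS]/(A' f) -[RHS]/(B' f) [f]laurentE lextE !linear_sum.
by apply: eq_bigr => a _; rewrite !linearZ; congr (_ *: _); apply: AB.
Qed.

Lemma lmulUU a b : lmul (ypow a) (ypow b) = ypow (a + b) :> laurent F r.
Proof. by rewrite !lmulE !lext_ypow. Qed.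

Lemma lmul_linr f : linear (lmul f).
Proof.
move=> c g h; rewrite !lmulE !(lextE _ f) scaler_sumr -big_split /=.
apply: eq_bigr => a _; rewrite linearP scalerDr.
by rewrite !scalerA mulrC.
Qed.

Lemma lmul_linl g : linear ((@lmul F r)^~ g).
Proof. by move=> c f h; rewrite !lmulE linearP. Qed.

Lemma lmulC : commutative (@lmul F r).
Proof.
move=> f g; move: g.
apply: (linear_ypow_eq (lmul_linr f) (lmul_linl f)) => b; move: f.
apply: (linear_ypow_eq (lmul_linl _) (lmul_linr _)) => a.
by rewrite !lmulUU addrC.
Qed.

Lemma lmulA : associative (@lmul F r).
Proof.
have linC (A B : laurent F r -> laurent F r) :
    linear A -> linear B -> linear (fun f => A (B f)).
  by move=> linA linB c f g; rewrite linB linA.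
move=> f g h; move: f.
apply: (linear_ypow_eq (lmul_linl _) (linC _ _ (lmul_linl h) (lmul_linl g))).
move=> a; move: g.
apply: (linear_ypow_eq (linC _ _ (lmul_linr (ypow a)) (lmul_linl h))
                       (linC _ _ (lmul_linl h) (lmul_linr (ypow a)))) => b.
move: h; apply: (linear_ypow_eq
  (linC _ _ (lmul_linr (ypow a)) (lmul_linr (ypow b))) (lmul_linr _)) => c.
by rewrite !lmulUU addrA.
Qed.

Lemma lmul1f : left_id (ypow 0) (@lmul F r).
Proof.
apply: (linear_ypow_eq (lmul_linr (ypow 0)) (B := id)) => // b.
by rewrite lmulUU add0r.
Qed.

Lemma lmulDl : left_distributive (@lmul F r) +%R.
Proof.
by move=> f g h; have := lmul_linl h 1 f g; rewrite !scale1r.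
Qed.

Lemma ypow0_neq0 : ypow 0 != 0 :> laurent F r.
Proof.
rewrite ypowE; apply/eqP => /(congr1 (mcoeff 0)) /eqP.
by rewrite mcoeffUU lcoeff0 oner_eq0.
Qed.

HB.instance Definition _ := GRing.Zmodule_isComNzRing.Build (laurent F r)
  lmulA lmulC lmul1f lmulDl ypow0_neq0.

Lemma lscaleAl (k : F) f g : k *: (f * g) = (k *: f) * g.
Proof. rewrite -[LHS]/(k *: lmul f g) -[RHS]/(lmul (k *: f) g).
have l0 : lmul 0 g = 0 by rewrite !lmulE linear0.
by rewrite -[k *: f]addr0 lmul_linl l0 addr0. Qed.

HB.instance Definition _ :=
  GRing.Lmodule_isLalgebra.Build F (laurent F r) lscaleAl.
HB.instance Definition _ :=
  GRing.Lalgebra_isComAlgebra.Build F (laurent F r).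

Lemma ypow0 : ypow 0 = 1 :> laurent F r.
Proof. by []. Qed.

Lemma ypowD a b : ypow (a + b) = ypow a * ypow b :> laurent F r.
Proof. by rewrite -[RHS]/(lmul _ _) lmulUU. Qed.

End LaurentRing.

(* f / d in the domain of Laurent polynomials: the quotient is unique if d != 0,
   and all the divisions below are exact (demW_dvd, metaT_dvd). *)
Definition ldiv (F : fieldType) r (f d : laurent F r) : laurent F r :=
  epsilon (inhabits 0) (fun h => h * d = f).

(* The inverse of a bijective operator. *)
Definition opinv (F : fieldType) r (T : laurent F r -> laurent F r)
    (f : laurent F r) : laurent F r :=
  epsilon (inhabits 0) (fun h => T h = f).

(* T_{i_1} ... T_{i_k} for a reduced expression s_{i_1} ... s_{i_k} of w. *)
Definition opw (F : fieldType) r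
    (T : 'I_r.-1 -> laurent F r -> laurent F r) (w : 'S_r)
    (f : laurent F r) : laurent F r :=
  foldr T f (redword w).

Definition lact (F : fieldType) r (w : 'S_r) : laurent F r -> laurent F r :=
  lext (fun lam => ypow (wact w lam)).

Definition iota_y (F : fieldType) r : laurent F r -> laurent F r :=
  lext (fun lam => ypow (- lam)).

(* f(y) |-> f(y^n). *)
Definition subst_pow (F : fieldType) r (n : nat) :
    laurent F r -> laurent F r :=
  lext (fun lam => ypow (lam *+ n)).

(* f(y) |-> f(y^{1/n}) for f in the image of subst_pow n. *)
Definition subst_root (F : fieldType) r (n : nat) :
    laurent F r -> laurent F r :=
  lext (fun lam => if wcongr n lam 0 then ypow (wfloor n lam) else 0).

(* The terms with exponents in a + n Z^r. *)
Definition component (F : fieldType) r (n : nat) (a : weight r) :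
    laurent F r -> laurent F r :=
  lext (fun lam => if wcongr n lam a then ypow lam else 0).

(* T_{i,q}. The two fractions are not Laurent polynomials separately, so they
   are put over their common denominator 1 - y^{alpha_i}. *)
Definition demW (F : fieldType) r (q : F) (i : 'I_r.-1) (f : laurent F r) :
    laurent F r :=
  ldiv ((ypow (alpha i) - (q ^- 2)%:A) * lact (srefl i) f + (q ^- 2 - 1) *: f)
       (1 - ypow (alpha i)).

(* psi^J_w(y; varpi^{-lam} w'; v), where s is the chosen v^{1/2}. *)
Definition parahoricW (F : fieldType) r (s : F) (J : {set 'I_r.-1})
    (w w' : 'S_r) (lam : weight r) : laurent F r :=
  (s ^+ 2) ^+ len w' *:
  (ypow (- rho r) *
   \sum_(u in wpara J)
     opw (demW s^-1) (wmul w u)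
       (opinv (opw (demW s^-1) w') (ypow (lam + rho r)))).

Section ExactDivision.
Variables (F : fieldType) (r : nat).
Implicit Types (f h d : laurent F r) (b : weight r).

Lemma dvd_geom b (m : int) :
  exists h : laurent F r, h * (1 - ypow b) = 1 - ypow (b *~ m).
Proof.
have nat_case k : exists h : laurent F r, h * (1 - ypow b) = 1 - ypow (b *+ k).
  elim: k => [|k [h Eh]]; first by exists 0; rewrite mul0r mulr0n ypow0 subrr.
  exists (h + ypow (b *+ k)).
  by rewrite mulrDl Eh mulrBr mulr1 -ypowD -mulrSr addrA subrK.
case: m => k; first exact: nat_case.
have [h Eh] := nat_case k.+1; exists (- (ypow (- (b *+ k.+1)) * h)).
by rewrite NegzE mulrNz mulNr -mulrA Eh mulrBr mulr1 -ypowD addNr ypow0 opprB.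
Qed.

Lemma metaT_dvd (n : nat) b (a : int) :
  exists h : laurent F r,
    h * (1 - ypow (b *+ n)) = 1 - ypow (b *~ ((a %% n%:Z)%Z - a)).
Proof.
have [h Eh] := dvd_geom (b *+ n) (- (a %/ n%:Z)%Z); exists h; rewrite Eh.
congr (1 - ypow _); rewrite pmulrn -mulrzA; congr (_ *~ _).
by rewrite {3}(divz_eq a n%:Z) opprD addrCA subrr addr0 mulrN mulrC.
Qed.

Lemma wact_srefl (i : 'I_r.-1) b :
  wact (srefl i) b = b - alpha i *~ (b (pos0 i) - b (pos1 i)).
Proof.
have neq : pos1 i != pos0 i by rewrite -val_eqE /= gtn_eqF.
apply/ffunP => j; rewrite !ffunE ffunMzE !ffunE /srefl tpermV.
case: tpermP => [->|->|/eqP/negPf-> /eqP/negPf->].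
- by rewrite eqxx eq_sym (negPf neq) subr0 mulrzz mul1r opprB addrC subrK.
- by rewrite eqxx (negPf neq) sub0r mulrzz mulN1r opprK addrC subrK.
by rewrite subrr mul0rz subr0.
Qed.

Lemma demW_dvd (q : F) (i : 'I_r.-1) f :
  exists h, h * (1 - ypow (alpha i)) =
    (ypow (alpha i) - (q ^- 2)%:A) * lact (srefl i) f + (q ^- 2 - 1) *: f.
Proof.
have [h Eh] : exists h, h * (1 - ypow (alpha i)) = lact (srefl i) f - f.
  have -> : lact (srefl i) f - f =
            lext (fun b => ypow (wact (srefl i) b) - ypow b) f.
    rewrite {2}[f]laurentE /lact !lextE -sumrB.
    by apply: eq_bigr => b _; rewrite scalerBr.
  rewrite lextE; elim: (enum_fset _) => [|b s [h Eh]].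
    by exists 0; rewrite mul0r big_nil.
  have [k Ek] := dvd_geom (alpha i) (- (b (pos0 i) - b (pos1 i))).
  exists (h - mcoeff b f *: (ypow b * k)).
  rewrite big_cons mulrBl Eh -scalerAl -mulrA Ek addrC wact_srefl.
  by rewrite mulrNz mulrBr mulr1 -ypowD -scalerN opprB.
exists ((1 - q ^- 2) *: h - lact (srefl i) f).
have -> : (q ^- 2 - 1) *: f = - ((1 - q ^- 2) *: f).
  by rewrite -scaleNr opprB.
rewrite mulrBl -scalerAl Eh mulrBr mulr1 [_ * ypow _]mulrC.
rewrite mulrBl -scalerAl mul1r scalerBr scalerBl scale1r opprB addrC.
by rewrite !addrA subrK.
Qed.

Lemma ldivK f d : (exists h, h * d = f) -> ldiv f d * d = f.
Proof. exact: epsilon_spec. Qed.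

End ExactDivision.

(* pi^m_v(T_i). From here on q stands for v^{1/2}. *)
Definition metaT (F : fieldType) r (n : nat) (q : F) (g : int -> F)
    (i : 'I_r.-1) : laurent F r -> laurent F r :=
  lext (fun lam : weight r =>
    let a := lam (pos0 i) - lam (pos1 i) in
    - (q * g (- a)) *: ypow (wact (srefl i) lam)
    + (q - q^-1) *:
      (ldiv (1 - ypow (alpha i *~ ((a %% n%:Z)%Z - a)))
            (1 - ypow (alpha i *+ n)) * ypow lam)).

(* T^m_{i,v}. *)
Definition metaDemW (F : fieldType) r (n : nat) (q : F) (g : int -> F)
    (i : 'I_r.-1) (f : laurent F r) : laurent F r :=
  - q *: (ypow (rho r) * opinv (metaT n q g i) (ypow (- rho r) * f)).

(* The component spherical function of theta at (y; varpi^{rho - mu}; v). *)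
Definition sphericalW (F : fieldType) r (n : nat) (q : F) (g : int -> F)
    (theta : {ffun 'I_r -> 'I_n}) (mu : weight r) : laurent F r :=
  component n (resid theta - rho r)
    (\sum_(w : 'S_r)
       iota_y (opw (metaDemW n q g) w (iota_y (ypow (mu - rho r))))).

(* h^{m,c}_v(w). *)
Definition hfac (F : fieldType) r (q : F) (g : int -> F) (c : weight r)
    (w : 'S_r) : F :=
  (- q) ^+ len w *
  \prod_(p : 'I_r * 'I_r | (p.1 < p.2)%N && (w p.2 < w p.1)%N)
    g (- (c p.1 - c p.2)).

(* The conditions determining (c, w, w') from theta and mu. *)
Definition wdata r (n : nat) (theta : {ffun 'I_r -> 'I_n}) (mu c : weight r)
    (w w' : 'S_r) : Prop :=
  [/\ decreasing c /\ (forall i, 1 <= c i <= n%:Z),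
      wcongr n (- mu) (wact w' c),
      wcongr n (- wact (longest [set: 'S_r]) (resid theta)) (wact w c),
      w' \in minrep (wstab c)
    & wmul (longest [set: 'S_r]) w \in minrep (wstab c)].

(* Main.v *)
(* The operators T_w^m conjugated by iota and y^rho become products of operators
   K_i satisfying a Bernstein relation K_i (f(y^n) m) = (s_i f)(y^n) K_i m +
   (v - 1) (N_i f)(y^n) m, with N_i the divided difference. On the regular
   model, the functions S_r -> F[y^{+-1}] with the same relation, the sum S of
   all the Hecke operators satisfies L_i S = v S = S L_i. The right equation
   turns S (U_w' P . delta_w') into a multiple of S (P . delta_1), with
   U_i = T_{i,q}; the left one expresses each coefficient of S (P . delta_1)
   through the one at w_0, where only the longest element contributes: the
   coefficient at w_0 z is a multiple of w_0 (U_z P). The map sending delta_x to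
   h(x) y^{x (n - c)} intertwines the L_i with the K_i, so it carries this
   formula over to the metaplectic side even if c has repeated entries; these
   repetitions produce the sum over W_c. *)
From Stdlib Require Import ClassicalEpsilon.
Require Import Defs.
From HB Require Import structures.
From mathcomp Require Import all_boot all_order all_algebra all_fingroup.
From mathcomp Require Import finmap ring zify.
From mathcomp.multinomials Require Import monalg.

Set Implicit Arguments.
Unset Strict Implicit.
Unset Printing Implicit Defensive.

Import Order.TTheory GRing.Theory Num.Theory.
Local Open Scope ring_scope.

(** * Length and reduced words in S_r *)

(** For repeated entries of [c] the monomials y^{x (n - c)} coincide for several x, so a coefficient
    at w_0 cannot be read off among Laurent polynomials; functions on S_r keep these x apart. There
    the equation S L_i = v S produces the U_i, because v s_i + (v - 1) N_i = - v U_i. The class of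
    theta collects the coefficients at x = w_0 w u with u in W_c. Their scalars agree: h(w_0 w u) =
    q^{l(u)} h(w_0 w), and l(w u) + l(u) = l(w) by minimality of w_0 w in its coset. What results is
    a sum over w W_c. Rewriting it as U_w applied to the sum over W_c costs v^{-l(w_c)}, since each
    U_i with s_i in W_c multiplies the latter sum by v^{-1}; and w_c has the length of the longest
    element of W_c. This is the origin of v^{l(w_0(W_c))} in C. The quadratic and braid relations
    are obtained from the Bernstein relation: once true at a vector m they are true at f m, so they
    are checked on generators only. *)

Section Length.
Variable r : nat.
Implicit Types (w x u : 'S_r) (i j : 'I_r.-1).

(** Left descent in terms of positions; it amounts to [s_i w] being shorter than [w]
    ([len_ldesc]). *)
Definition ldesc i w : bool := (w^-1%g (pos1 i) < w^-1%g (pos0 i))%N.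

Definition invset w : {set 'I_r * 'I_r} :=
  [set p : 'I_r * 'I_r | (p.1 < p.2)%N && (w p.2 < w p.1)%N].

Lemma pos01 i : (pos0 i == pos1 i) = false.
Proof. by apply/eqP => /(congr1 val) /= E; lia. Qed.

Lemma ldescN i w :
  ~~ ldesc i w = (w^-1%g (pos0 i) < w^-1%g (pos1 i))%N.
Proof.
rewrite /ldesc -leqNgt leq_eqVlt; case: eqP => // /val_inj /perm_inj /eqP.
by rewrite pos01.
Qed.

Lemma sreflK i : (srefl i * srefl i = 1)%g. Proof. exact: tperm2. Qed.
Lemma sreflV i : (srefl i)^-1%g = srefl i. Proof. exact: tpermV. Qed.

Lemma wmul_sreflK i : involutive (wmul (srefl i)).
Proof. by move=> w; rewrite /wmul -mulgA sreflK mulg1. Qed.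

Lemma srefl_inv i w k :
  (wmul (srefl i) w)^-1%g k = w^-1%g (srefl i k).
Proof. by rewrite /wmul invMg sreflV permM. Qed.

Lemma srefl_pos0 i : srefl i (pos0 i) = pos1 i. Proof. exact: tpermL. Qed.
Lemma srefl_pos1 i : srefl i (pos1 i) = pos0 i. Proof. exact: tpermR. Qed.

Lemma ldesc_srefl i w : ldesc i (wmul (srefl i) w) = ~~ ldesc i w.
Proof. by rewrite ldescN /ldesc !srefl_inv srefl_pos0 srefl_pos1. Qed.

Lemma srefl_lt i (k l : 'I_r) : (k < l)%N ->
  (srefl i k < srefl i l)%N = ~~ ((k == pos0 i) && (l == pos1 i)).
Proof.
rewrite /srefl => kl.
case: tpermP => [Ek|Ek|/eqP+ /eqP+]; case: tpermP => [El|El|/eqP+ /eqP+];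
  rewrite ?Ek ?El -?val_eqE /= in kl *; lia.
Qed.

(** By [srefl_lt], [s_i] preserves the order of every pair of values except [(pos0 i, pos1 i)], so
    only the pair of their preimages changes status. *)
Lemma invset_srefl i w : ~~ ldesc i w ->
  invset (wmul (srefl i) w) = (w^-1%g (pos0 i), w^-1%g (pos1 i)) |: invset w.
Proof.
move=> nd; apply/setP => -[k l]; rewrite !inE /= /wmul !permM xpair_eqE.
rewrite -(can2_eq (permK w) (permKV w)) -[l == _](can2_eq (permK w) (permKV w)).
have [kl|lk] := ltnP k l; last first.
  rewrite orbF; apply/esym/negP => /andP[/eqP Ek /eqP El].
  by move: nd lk; rewrite ldescN -Ek -El !permK; lia.
have [wlk|wkl] := ltnP (w l) (w k).
  rewrite orbT srefl_lt //; apply/negP => /andP[/eqP El /eqP Ek].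
  by move: nd kl; rewrite ldescN -Ek -El !permK; lia.
rewrite orbF /=; have {}wkl : (w k < w l)%N.
  by rewrite ltn_neqAle wkl andbT; apply/negP => /eqP/val_inj/perm_inj E;
    rewrite E ltnn in kl.
have neq : (srefl i (w k) != srefl i (w l) :> nat).
  by rewrite val_eqE (inj_eq perm_inj) -val_eqE /=; lia.
by have := srefl_lt i wkl; move: neq; case: (_ && (w l == _)); lia.
Qed.

Lemma invset_notin i w :
  (w^-1%g (pos0 i), w^-1%g (pos1 i)) \notin invset w.
Proof. by rewrite inE /= !permKV /=; lia. Qed.

Definition ninv w := #|invset w|.

Lemma ninv_srefl i w : ~~ ldesc i w -> ninv (wmul (srefl i) w) = (ninv w).+1.
Proof. by move=> nd; rewrite /ninv invset_srefl // cardsU1 invset_notin. Qed.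

Lemma ninv1 : ninv 1 = 0%N.
Proof.
by apply/eqP; rewrite cards_eq0; apply/eqP/setP => -[k l];
  rewrite !inE /= !perm1; lia.
Qed.

Lemma ninv_word (t : seq 'I_r.-1) : (ninv (word_perm t) <= size t)%N.
Proof.
elim: t => [|i t IH] /=; first by rewrite ninv1.
have [d|nd] := boolP (ldesc i (word_perm t)); last by rewrite ninv_srefl.
have := ninv_srefl (i := i) (w := wmul (srefl i) (word_perm t)).
by rewrite ldesc_srefl d wmul_sreflK => /(_ isT); lia.
Qed.

(** Without descents [w^-1] is increasing, so [k <= w^-1 k]. The largest [k] moved by [w^-1] would
    share its image with the fixed point [w^-1 k]. *)
Lemma no_desc1 w : (forall i, ~~ ldesc i w) -> w = 1%g.
Proof.
move=> nd; have mono (k l : 'I_r) : (k <= l)%N -> (w^-1%g k <= w^-1%g l)%N.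
  move: l => [l ltl] /=; elim: l ltl => [|l IH] ltl kl.
    by rewrite (_ : k = Ordinal ltl) //; apply: val_inj => /=; lia.
  have [E|lt] := eqVneq (k : nat) l.+1.
    by rewrite (_ : k = Ordinal ltl) //; apply: val_inj.
  have ltl' : (l < r.-1)%N by lia.
  have := nd (Ordinal ltl'); rewrite ldescN.
  have -> : pos1 (Ordinal ltl') = Ordinal ltl by apply: val_inj.
  have ltl2 : (l < r)%N by lia.
  have -> : pos0 (Ordinal ltl') = Ordinal ltl2 by apply: val_inj.
  have := IH ltl2; lia.
have ge (k : 'I_r) : (k <= w^-1%g k)%N.
  move: k => [k]; elim: k => [|k IH] ltk //=.
  have ltk' : (k < r)%N by lia.
  have := IH ltk'; have := mono (Ordinal ltk') (Ordinal ltk) (leqnSn k).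
  have : (w^-1%g (Ordinal ltk')) != (w^-1%g (Ordinal ltk)).
    by apply/eqP => /perm_inj /(congr1 val) /=; lia.
  rewrite -val_eqE /=; lia.
suff E : w^-1%g = 1%g by rewrite -[w]invgK E invg1.
apply/permP => k; rewrite perm1.
have [m] := ubnP (r - k)%N; elim: m k => [|m IH] k lem; first by [].
apply: ord_inj; apply/eqP; rewrite eqn_leq ge andbT leqNgt; apply/negP => lt.
have : (r - w^-1%g k < m)%N by have := ltn_ord (w^-1%g k); lia.
by move=> /IH /perm_inj /(congr1 val) /= E; rewrite E ltnn in lt.
Qed.

Lemma ninv_word_ex w : exists t, word_perm t = w /\ size t = ninv w.
Proof.
move E: (ninv w) => m; elim: m w E => [|m IH] w E.
  exists [::]; split=> //=; apply/esym/no_desc1 => i; apply/negP => d.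
  have := ninv_srefl (i := i) (w := wmul (srefl i) w).
  by rewrite ldesc_srefl d wmul_sreflK => /(_ isT); lia.
have [/existsP[i d]|/existsPn/no_desc1 E1] := boolP [exists i, ldesc i w];
  last first.
  by move: E; rewrite E1 ninv1.
have := ninv_srefl (i := i) (w := wmul (srefl i) w).
rewrite ldesc_srefl d wmul_sreflK E => /(_ isT) [/esym/IH[t [Et st]]].
by exists (i :: t); rewrite /= Et wmul_sreflK st.
Qed.

(** A letter adds at most one inversion and stripping a descent removes exactly one, so the two
    numbers bound each other. *)
Lemma lenE w : len w = ninv w.
Proof.
rewrite /len; case: ex_minnP => k /existsP[t /eqP Et] min.
apply/eqP; rewrite eqn_leq -{2}Et; apply/andP; split; last first.
  by have := ninv_word t; rewrite size_tuple.
have [s [Es ss]] := ninv_word_ex w; apply: min; rewrite -ss.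
by apply/existsP; exists (in_tuple s); apply/eqP.
Qed.

Lemma len1 : len (1 : 'S_r) = 0%N. Proof. by rewrite lenE ninv1. Qed.

Lemma len_srefl i w : ~~ ldesc i w -> len (wmul (srefl i) w) = (len w).+1.
Proof. by rewrite !lenE; apply: ninv_srefl. Qed.

Lemma len_sreflD i w : ldesc i w -> len w = (len (wmul (srefl i) w)).+1.
Proof.
move=> d; rewrite -[in LHS](wmul_sreflK i w) len_srefl //.
by rewrite ldesc_srefl d.
Qed.

Lemma len_ldesc i w : ldesc i w = (len (wmul (srefl i) w) < len w)%N.
Proof.
have [/len_sreflD->|/len_srefl->] := boolP (ldesc i w); rewrite ?ltnS ?leqnn //.
by rewrite ltnNge leqnSn.
Qed.

Lemma len_word (t : seq 'I_r.-1) : (len (word_perm t) <= size t)%N.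
Proof. by rewrite lenE; apply: ninv_word. Qed.

Lemma size_redword w : size (redword w) = len w.
Proof. by rewrite size_tuple. Qed.

Lemma redwordK w : word_perm (redword w) = w.
Proof. exact/eqP/(xchooseP (redword_ex w)). Qed.

(** Induction along the left weak order: the steps are the letters of a reduced word, whose tails
    are again reduced. *)
Lemma perm_lind (P : 'S_r -> Prop) : P 1%g ->
  (forall i w, ~~ ldesc i w -> P w -> P (wmul (srefl i) w)) -> forall w, P w.
Proof.
move=> P1 PS w; move E: (len w) => m; elim: m w E => [|m IH] w E.
  have := size_redword w; rewrite E => /size0nil Er.
  by rewrite -(redwordK w) Er.
have := size_redword w; rewrite E; have := redwordK w.
case: (redword w) => //= i t Et [st].
have lt : len (word_perm t) = m.
  have := len_word t; rewrite st.
  have [d|nd] := boolP (ldesc i (word_perm t)); last first.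
    by move/len_srefl: nd; rewrite Et E; lia.
  by move/len_sreflD: d; rewrite Et E; lia.
rewrite -Et; apply: PS; last exact: IH.
by rewrite len_ldesc Et E lt; lia.
Qed.

Lemma word_perm_rev t : word_perm (rev t) = (word_perm t)^-1%g :> 'S_r.
Proof.
elim: t => [|i t IH]; first by rewrite /= invg1.
by rewrite rev_cons -cats1 word_perm_cat IH /= /wmul mul1g invMg sreflV.
Qed.

Lemma len_inv w : len w^-1%g = len w.
Proof.
have le u : (len u^-1%g <= len u)%N.
  rewrite -{1}(redwordK u) -word_perm_rev.
  by rewrite (leq_trans (len_word _)) // size_rev size_redword.
by apply/eqP; rewrite eqn_leq le -{1}[w]invgK le.
Qed.

Lemma len_eq0 w : len w = 0%N -> w = 1%g.
Proof. by move=> E; have := size_redword w; rewrite E => /size0nil Er;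
  rewrite -(redwordK w) Er. Qed.

Definition reduced (t : seq 'I_r.-1) w := word_perm t = w /\ size t = len w.

Lemma reduced_redword w : reduced (redword w) w.
Proof. by split; [apply: redwordK | apply: size_redword]. Qed.

Lemma reduced_cons i t w :
  reduced (i :: t) w <-> ldesc i w /\ reduced t (wmul (srefl i) w).
Proof.
split=> [[/= <- st]|[d [Et st]]].
  have d : ldesc i (wmul (srefl i) (word_perm t)).
    by rewrite len_ldesc wmul_sreflK -st ltnS len_word.
  by move: st; rewrite (len_sreflD d) wmul_sreflK => -[].
by rewrite /reduced /= Et st wmul_sreflK (len_sreflD d).
Qed.

(** * Matsumoto's theorem: independence of the reduced word *)

Section Matsumoto.
Variables (X : Type) (T : 'I_r.-1 -> X -> X).
Hypothesis far : forall i j m, (i.+1 < j)%N -> T i (T j m) = T j (T i m).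
Hypothesis near : forall i j m, j = i.+1 :> nat ->
  T i (T j (T i m)) = T j (T i (T j m)).

(** At two descents the longest element of the subgroup generated by [s_i] and [s_j] splits off on
    the left of [w]. Its two reduced words start with [i] and with [j], and the operators agree on
    them by [far] or [near]. *)
Lemma reduced_braid i j w m : (i < j)%N -> ldesc i w -> ldesc j w ->
  exists s t, [/\ reduced (i :: s) w, reduced (j :: t) w &
    foldr T m (i :: s) = foldr T m (j :: t)].
Proof.
move=> ij di dj.
have [ji|ji] := eqVneq (j : nat) i.+1.
  have p1 : pos1 i = pos0 j by apply: val_inj.
  have n0 : srefl j (pos0 i) = pos0 i.
    by rewrite tpermD // -val_eqE /=; lia.
  have n1 : srefl i (pos1 j) = pos1 j.
    by rewrite tpermD // -val_eqE /=; lia.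
  pose u := redword (wmul (srefl i) (wmul (srefl j) (wmul (srefl i) w))).
  have E : wmul (srefl i) (wmul (srefl j) (wmul (srefl i) w)) =
           wmul (srefl j) (wmul (srefl i) (wmul (srefl j) w)).
    rewrite /wmul -!mulgA; congr (_ * _)%g.
    have Ei : (srefl i * (srefl j * srefl i) = srefl j ^ srefl i)%g.
      by rewrite conjgE sreflV.
    have Ej : (srefl j * (srefl i * srefl j) = srefl i ^ srefl j)%g.
      by rewrite conjgE sreflV.
    by rewrite Ei Ej !tpermJ n0 n1 -p1 srefl_pos1 p1 srefl_pos0.
  exists [:: j, i & u], [:: i, j & u]; split; last by rewrite /= near.
    apply/reduced_cons; split=> //; apply/reduced_cons; split.
      by rewrite /ldesc !srefl_inv n1 -p1 srefl_pos1; move: di dj;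
        rewrite /ldesc p1; lia.
    apply/reduced_cons; split; last exact: reduced_redword.
    by rewrite /ldesc !srefl_inv n0 srefl_pos0 p1 srefl_pos0 n1.
  apply/reduced_cons; split=> //; apply/reduced_cons; split.
    by rewrite /ldesc !srefl_inv n0 p1 srefl_pos0; move: di dj;
      rewrite /ldesc p1; lia.
  apply/reduced_cons; split; last by rewrite /u E; exact: reduced_redword.
  by rewrite /ldesc !srefl_inv n1 srefl_pos1 -p1 srefl_pos1 n0.
have {}ij : (i.+1 < j)%N by lia.
have fixj k : (k == pos0 i) || (k == pos1 i) -> srefl j k = k.
  by move=> /orP[]/eqP->; rewrite tpermD // -val_eqE /=; lia.
have fixi k : (k == pos0 j) || (k == pos1 j) -> srefl i k = k.
  by move=> /orP[]/eqP->; rewrite tpermD // -val_eqE /=; lia.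
pose u := redword (wmul (srefl j) (wmul (srefl i) w)).
have E : wmul (srefl j) (wmul (srefl i) w) = wmul (srefl i) (wmul (srefl j) w).
  rewrite /wmul -!mulgA; congr (_ * _)%g.
  have E : (srefl i ^ srefl j = srefl i)%g.
    by rewrite tpermJ !fixj ?eqxx ?orbT.
  by rewrite -{2}E conjgE sreflV mulgA sreflK mul1g.
exists (j :: u), (i :: u); split; last by rewrite /= far.
  apply/reduced_cons; split=> //; apply/reduced_cons; split;
    last exact: reduced_redword.
  by rewrite /ldesc !srefl_inv !fixi ?eqxx ?orbT.
apply/reduced_cons; split=> //; apply/reduced_cons; split;
  last by rewrite /u E; exact: reduced_redword.
by rewrite /ldesc !srefl_inv !fixj ?eqxx ?orbT.
Qed.

(** Induction on the length. The first letters of [s] and [t] are descents of [w]; if they differ,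
    the induction hypothesis exchanges the tails for those of [reduced_braid]. *)
Lemma matsumoto w (s t : seq 'I_r.-1) m :
  reduced s w -> reduced t w -> foldr T m s = foldr T m t.
Proof.
move E: (len w) => k; elim: k w s t m E => [|k IH] w s t m E.
  by move=> [_ ss] [_ st]; rewrite E in ss st;
    rewrite (size0nil ss) (size0nil st).
case: s t => [|i s] [|j t]; try by move=> [? /=]; rewrite E.
  by move=> _ [? /=]; rewrite E.
move=> /[dup] rs /reduced_cons[di rs1] /[dup] rt /reduced_cons[dj rt1].
have lk l : ldesc l w -> len (wmul (srefl l) w) = k.
  by move=> d; move: E; rewrite (len_sreflD d) => -[].
have [ij|ji|/val_inj ij] := ltngtP i j; last first.
- by rewrite -ij in rt1 *; rewrite /=; congr (T i _);
    exact: IH (lk _ di) rs1 rt1.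
- have [t' [s' [/reduced_cons[_ rt'] /reduced_cons[_ rs'] Eb]]] :=
    reduced_braid m ji dj di.
  rewrite /= (IH _ _ _ m (lk _ di) rs1 rs') (IH _ _ _ m (lk _ dj) rt1 rt').
  exact/esym.
have [s' [t' [/reduced_cons[_ rs'] /reduced_cons[_ rt'] Eb]]] :=
  reduced_braid m ij di dj.
by rewrite /= (IH _ _ _ m (lk _ di) rs1 rs') (IH _ _ _ m (lk _ dj) rt1 rt').
Qed.
End Matsumoto.
End Length.

(** * Hecke operators indexed by permutations *)

Section LinearMaps.
Variables (F : fieldType) (V W : lmodType F) (f : V -> W).
Hypothesis flin : linear f.

Lemma linD x y : f (x + y) = f x + f y.
Proof. by have := flin 1 x y; rewrite !scale1r. Qed.

Lemma lin0 : f 0 = 0.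
Proof. by apply: (addrI (f 0)); rewrite -linD !addr0. Qed.

Lemma linZ a x : f (a *: x) = a *: f x.
Proof. by have := flin a x 0; rewrite lin0 !addr0. Qed.

Lemma linN x : f (- x) = - f x.
Proof. by rewrite -scaleN1r linZ scaleN1r. Qed.

Lemma linB x y : f (x - y) = f x - f y.
Proof. by rewrite linD linN. Qed.

Lemma lin_sum (I : Type) (s : seq I) (P : pred I) (E : I -> V) :
  f (\sum_(i <- s | P i) E i) = \sum_(i <- s | P i) f (E i).
Proof. exact: (big_morph f linD lin0). Qed.
End LinearMaps.

Section HeckeAction.
Variable r : nat.
Implicit Types (w x u : 'S_r) (i j : 'I_r.-1).

Section Operators.
Variables (X : Type) (T : 'I_r.-1 -> X -> X).

(** [opw] for an arbitrary carrier, so that Laurent polynomials and the regular module are treated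
    alike. *)
Definition hop w (m : X) : X := foldr T m (redword w).

Lemma hop1 m : hop 1 m = m.
Proof.
by rewrite /hop; have := size_redword (1 : 'S_r); rewrite len1 => /size0nil->.
Qed.

Hypothesis far : forall i j m, (i.+1 < j)%N -> T i (T j m) = T j (T i m).
Hypothesis near : forall i j m, j = i.+1 :> nat ->
  T i (T j (T i m)) = T j (T i (T j m)).

Lemma hop_reduced w t m : reduced t w -> hop w m = foldr T m t.
Proof. exact: (matsumoto far near) (reduced_redword w). Qed.

Lemma hop_srefl i w m :
  ~~ ldesc i w -> hop (wmul (srefl i) w) m = T i (hop w m).
Proof.
move=> nd; rewrite (@hop_reduced _ (i :: redword w)) //.
apply/reduced_cons; rewrite ldesc_srefl wmul_sreflK nd.
by split=> //; apply: reduced_redword.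
Qed.

Lemma hop_mul w u m :
  len (wmul w u) = (len w + len u)%N -> hop (wmul w u) m = hop w (hop u m).
Proof.
move=> E; rewrite (@hop_reduced _ (redword w ++ redword u)) ?foldr_cat //.
by split; rewrite ?word_perm_cat ?redwordK // size_cat !size_redword.
Qed.
End Operators.

Section Linear.
Variables (F : fieldType) (X : lmodType F) (T : 'I_r.-1 -> X -> X).
Hypothesis far : forall i j m, (i.+1 < j)%N -> T i (T j m) = T j (T i m).
Hypothesis near : forall i j m, j = i.+1 :> nat ->
  T i (T j (T i m)) = T j (T i (T j m)).
Hypothesis Tlin : forall i, linear (T i).
Variable v : F.
Hypothesis quad : forall i m, T i (T i m) = (v - 1) *: T i m + v *: m.

Lemma hop_linear w : linear (hop T w).
Proof.
by rewrite /hop => a m n; elim: (redword w) => //= i t ->; rewrite Tlin.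
Qed.

(** [T_i] multiplies each pair [T_u + T_{s_i u}] by the root [v] of the quadratic relation
    [(T - v)(T + 1) = 0]. The set [G] will be all of [S_r], and the stabilizer of [c]. *)
Lemma hop_sum_left (G : {set 'S_r}) i m :
  (forall u, u \in G -> wmul (srefl i) u \in G) ->
  T i (\sum_(u in G) hop T u m) = v *: \sum_(u in G) hop T u m.
Proof.
move=> GS; rewrite (bigID (ldesc i)) /=.
have GSE u : (wmul (srefl i) u \in G) = (u \in G).
  by apply/idP/idP => /GS //; rewrite wmul_sreflK.
rewrite (reindex_inj (can_inj (wmul_sreflK i))) /=.
under eq_bigl => u do rewrite GSE ldesc_srefl.
rewrite -big_split /= (lin_sum (Tlin i)) scaler_sumr; apply: eq_bigr => u.
case/andP=> _ nd; rewrite (hop_srefl far near) // (linD (Tlin i)) quad scalerDr.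
by rewrite scalerBl scale1r addrAC subrK.
Qed.

Lemma hop_sum_right i m :
  \sum_w hop T w (T i m) = v *: \sum_w hop T w m.
Proof.
pose rd w := ldesc i w^-1%g.
have rmulK : involutive (fun w : 'S_r => wmul w (srefl i)).
  by move=> w; rewrite /wmul mulgA sreflK mul1g.
have rinv w : (wmul w (srefl i))^-1%g = wmul (srefl i) w^-1%g.
  by rewrite /wmul invMg sreflV.
(* Right ascents of [w] are left ascents of [w^-1]; there lengths add and [T_{w s_i} = T_w T_i]. *)
have Tr w n : ~~ rd w -> hop T (wmul w (srefl i)) n = hop T w (T i n).
  move=> nd; have E u : ~~ rd u -> len (wmul u (srefl i)) = (len u).+1.
    by move=> ndu; rewrite -len_inv rinv len_srefl // len_inv.
  have s1 : wmul (srefl i) 1%g = srefl i by rewrite /wmul mul1g.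
  have nd1 : ~~ ldesc i 1%g by rewrite ldescN invg1 !perm1.
  have Es : hop T (srefl i) n = T i n.
    by rewrite -[in LHS]s1 (hop_srefl far near) // hop1.
  by rewrite (hop_mul far near) ?Es // E // -s1 len_srefl ?len1 // addn1.
rewrite (bigID rd) /= [in RHS](bigID rd) /=.
rewrite (reindex_inj (inv_inj rmulK)) [in RHS](reindex_inj (inv_inj rmulK)) /=.
have P w : rd (wmul w (srefl i)) = ~~ rd w by rewrite /rd rinv ldesc_srefl.
rewrite (eq_bigl (fun w => ~~ rd w) _ P) [in RHS](eq_bigl (fun w => ~~ rd w) _
  P).
rewrite -!big_split /= scaler_sumr; apply: eq_bigr => w nd.
rewrite !Tr // quad (linD (hop_linear w)) !(linZ (hop_linear w)).
by rewrite scalerDr scalerBl scale1r addrAC subrK.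
Qed.
End Linear.
End HeckeAction.

(** * Parabolic cosets *)

Section Combinatorics.
Variable r : nat.
Implicit Types (w x y u z : 'S_r) (i j : 'I_r.-1) (c d : weight r).

Lemma wactE w c k : wact w c (w k) = c k.
Proof. by rewrite ffunE permK. Qed.

Lemma wactM w u c : wact (wmul w u) c = wact w (wact u c).
Proof. by apply/ffunP => k; rewrite !ffunE /wmul invMg permM. Qed.

Lemma wact1 c : wact 1%g c = c.
Proof. by apply/ffunP => k; rewrite ffunE invg1 perm1. Qed.

Lemma wactV w c d : (wact w c == d) = (c == wact w^-1%g d).
Proof.
by apply/eqP/eqP => [<-|->]; rewrite -wactM /wmul ?mulgV ?mulVg wact1.
Qed.

Lemma wact_inj w : injective (wact (r := r) w).
Proof.
by move=> c d /eqP; rewrite wactV -wactM /wmul mulgV wact1 => /eqP.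
Qed.

Lemma wstab1 c : 1%g \in wstab c. Proof. by rewrite inE wact1. Qed.

Lemma wstabM c w u : w \in wstab c -> u \in wstab c -> wmul w u \in wstab c.
Proof. by rewrite !inE wactM => + /eqP->. Qed.

Lemma wstabV c w : w \in wstab c -> w^-1%g \in wstab c.
Proof. by rewrite !inE wactV eq_sym. Qed.

Lemma wstabE c u k : u \in wstab c -> c (u k) = c k.
Proof. by rewrite inE => /eqP Eu; rewrite -[in LHS]Eu wactE. Qed.

Lemma wmulA : associative (@wmul r).
Proof. by move=> x y z; rewrite /wmul mulgA. Qed.

Lemma wmulV w : wmul w w^-1%g = 1%g. Proof. exact: mulVg. Qed.
Lemma wmulVl w : wmul w^-1%g w = 1%g. Proof. exact: mulgV. Qed.
Lemma wmul1l w : wmul 1%g w = w. Proof. exact: mulg1. Qed.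
Lemma wmul1r w : wmul w 1%g = w. Proof. exact: mul1g. Qed.
Lemma wmul_inj w : injective (wmul w). Proof. exact: mulIg. Qed.

Definition w0 : 'S_r := longest [set: 'S_r].

Lemma len_w0 w : (len w <= len w0)%N.
Proof.
rewrite /w0 /longest; case: arg_maxnP => [|x _ max]; first by rewrite inE.
by apply: max; rewrite inE.
Qed.

(** Composed with the order reversal, [w] has no descent left and [no_desc1] applies. *)
Lemma all_desc_rev w : (forall i, ldesc i w) -> forall k, w^-1%g k = rev_ord k.
Proof.
move=> d; pose v0 : 'S_r := perm (@rev_ord_inj r).
suff /(congr1 (fun u : 'S_r => u^-1%g)) : (v0^-1 * w)%g = 1%g.
  rewrite invMg invgK invg1 => E k.
  have := congr1 (fun u : 'S_r => u k) E; rewrite permM perm1 permE => E2.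
  by rewrite -[LHS]rev_ordK E2.
apply: no_desc1 => i; rewrite ldescN invMg invgK !permM !(permE (@rev_ord_inj
  r)).
move: (d i); rewrite /ldesc; move: (w^-1%g (pos0 i)) (w^-1%g (pos1 i)) => a b
  /=.
by have := ltn_ord a; lia.
Qed.

Lemma max_len_rev w :
  (forall u, len u <= len w)%N -> forall k, w^-1%g k = rev_ord k.
Proof.
move=> max; apply: all_desc_rev => i; apply/negPn/negP => nd.
by have := max (wmul (srefl i) w); rewrite len_srefl // ltnn.
Qed.

Lemma w0V k : w0^-1%g k = rev_ord k.
Proof. by move: k; apply: max_len_rev; apply: len_w0. Qed.

Lemma w0E k : w0 k = rev_ord k.
Proof. by apply: (perm_inj (s := w0^-1%g)); rewrite permK w0V rev_ordK. Qed.

Lemma w0_inv : w0^-1%g = w0.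
Proof. by apply/permP => k; rewrite w0V w0E. Qed.

Lemma wmul_w0K : involutive (wmul w0).
Proof. by move=> w; rewrite wmulA -{1}w0_inv wmulVl wmul1l. Qed.

Lemma len_w0_uniq w : (len w0 <= len w)%N -> w = w0.
Proof.
move=> le; apply: invg_inj; apply/permP => k; rewrite w0V.
by apply: max_len_rev => u; rewrite (leq_trans (len_w0 u)).
Qed.

Lemma w0_pos0 i : w0 (pos0 i) = pos1 (rev_ord i).
Proof. by rewrite w0E; apply: val_inj => /=; have := ltn_ord i; lia. Qed.

Lemma w0_pos1 i : w0 (pos1 i) = pos0 (rev_ord i).
Proof. by rewrite w0E; apply: val_inj => /=; have := ltn_ord i; lia. Qed.

Lemma w0_srefl i : wmul w0 (srefl i) = wmul (srefl (rev_ord i)) w0.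
Proof.
have -> : srefl (rev_ord i) = (srefl i ^ w0)%g.
  by rewrite tpermJ w0_pos0 w0_pos1 tpermC.
by rewrite /wmul conjgE mulKVg.
Qed.

Lemma ldesc_w0 i z : ldesc (rev_ord i) (wmul w0 z) = ~~ ldesc i z.
Proof.
rewrite ldescN /ldesc /wmul !invMg !permM w0_inv.
by rewrite -w0_pos0 -w0_pos1 !w0E !rev_ordK.
Qed.

(** [w_0] conjugates [s_i] into [s_{rev i}] and exchanges descents with ascents, so each letter of
    [z] shortens [w_0 z] by one. *)
Lemma len_w0_mul z : (len (wmul w0 z) + len z = len w0)%N.
Proof.
move: z; apply: perm_lind => [|i w nd IH]; first by rewrite wmul1r len1 addn0.
rewrite wmulA w0_srefl -wmulA (len_srefl nd) -IH.
have : ldesc (rev_ord i) (wmul w0 w) by rewrite ldesc_w0.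
by move/len_sreflD => ->; rewrite addSnnS.
Qed.

(** * Minimal coset representatives for the stabilizer of a decreasing tuple *)

Section Stabilizer.
Variable c : weight r.

(** For decreasing [c] this is membership in [minrep (wstab c)] ([minrepP]), in a form suited to
    inductions along the left weak order. *)
Definition blockinc x :=
  forall a b : 'I_r, (a < b)%N -> c a = c b -> (x a < x b)%N.

Lemma Jset_stab i : i \in Jset c -> srefl i \in wstab c.
Proof.
by rewrite !inE wact_srefl => /eqP->; rewrite subrr mulr0z subr0.
Qed.

Hypothesis cdec : decreasing c.

Lemma dec_le (a b : 'I_r) : (a < b)%N -> c a != c b -> c b < c a.
Proof. by move=> ab ne; rewrite lt_neqAle eq_sym ne cdec // ltnW. Qed.

(** [c] is decreasing and invariant under [u], so an inversion of two neighbours under [u^-1] forces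
    the same entry at both. Hence weak order inductions stay inside the stabilizer. *)
Lemma wstab_ldesc i u : u \in wstab c -> ldesc i u -> i \in Jset c.
Proof.
move=> /wstabV Su; rewrite /ldesc inE => lt.
have := cdec (ltnW lt); rewrite !(wstabE _ Su) => le.
by rewrite eq_le le cdec //=.
Qed.

Lemma wstab_srefl i u : u \in wstab c -> ldesc i u ->
  wmul (srefl i) u \in wstab c.
Proof. by move=> Su /(wstab_ldesc Su) /Jset_stab Ss; apply: wstabM. Qed.

(* The left weak order is compatible with cosets: a step down from a block-
   increasing permutation stays block-increasing and crosses two blocks. *)
Lemma blockinc_step i x : ~~ ldesc i x -> blockinc (wmul (srefl i) x) ->
  blockinc x /\ c (x^-1%g (pos1 i)) < c (x^-1%g (pos0 i)).
Proof.
move=> nd bi; have lt : c (x^-1%g (pos1 i)) < c (x^-1%g (pos0 i)).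
  move: nd; rewrite ldescN => lt; apply: dec_le => //; apply/eqP => E.
  have := bi _ _ lt E; rewrite /wmul !permM !permKV srefl_pos0 srefl_pos1 /=.
  by rewrite ltnNge leqnSn.
split=> // a b ab E; have := bi a b ab E; rewrite /wmul !permM.
case: (ltngtP (x a) (x b)) => // [xba|/val_inj/perm_inj Eab]; last first.
  by rewrite Eab ltnn in ab.
move=> /ltnW; rewrite leqNgt (srefl_lt i xba) negbK => /andP[/eqP Eb /eqP Ea].
move: lt.
by rewrite -Ea -Eb !permK E ltxx.
Qed.

(** [u] moves positions only within blocks of equal entries, whereas by [blockinc_step] the two
    positions compared lie in different blocks. *)
Lemma stab_step i x u : ~~ ldesc i x -> blockinc (wmul (srefl i) x) ->
  u \in wstab c -> ~~ ldesc i (wmul x u).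
Proof.
move=> nd /(blockinc_step nd)[_ lt] /wstabV Su; rewrite ldescN.
rewrite ltnNge; apply/negP => le; move: lt; rewrite ltNge => /negP; apply.
move: le; rewrite /wmul invMg !permM => /cdec.
by rewrite !(wstabE _ Su).
Qed.

Lemma len_stab x u : blockinc x -> u \in wstab c ->
  len (wmul x u) = (len x + len u)%N.
Proof.
move=> bx Su; move: x bx; apply: perm_lind => [|i x nd IH bx].
  by rewrite wmul1l len1.
have [bx' _] := blockinc_step nd bx.
by rewrite -wmulA !len_srefl ?(stab_step nd bx) // IH.
Qed.

(** Minimality against one simple reflection of the stabilizer gives the increase at neighbouring
    positions of a block. As [c] is decreasing, blocks are intervals and these increases chain
    up. *)
Lemma minrepP x : x \in minrep (wstab c) <-> blockinc x.
Proof.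
split=> [|bx]; last first.
  by rewrite inE; apply/forall_inP => u Su; rewrite len_stab // leq_addr.
rewrite inE => /forall_inP min a b ab Ecab.
rewrite ltn_neqAle; apply/andP; split.
  by apply/negP => /eqP /val_inj/perm_inj E; rewrite E ltnn in ab.
move: b ab Ecab => [b ltb] /=.
elim: b ltb => // b IH ltb; rewrite ltnS => ab Ec.
have ltb' : (b < r)%N by lia.
have ltb2 : (b < r.-1)%N by lia.
have E1 : pos1 (Ordinal ltb2) = Ordinal ltb by apply: val_inj.
have E0 : pos0 (Ordinal ltb2) = Ordinal ltb' by apply: val_inj.
have Ec' : c (Ordinal ltb') = c (Ordinal ltb).
  apply/le_anti; rewrite -{1}Ec !cdec //=.
have : (x (Ordinal ltb') <= x (Ordinal ltb))%N.
  have Ss : srefl (Ordinal ltb2) \in wstab c.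
    by apply: Jset_stab; rewrite inE E0 E1 Ec'.
  have := min _ Ss; rewrite -[len x]len_inv -[len (wmul _ _)]len_inv.
  rewrite /wmul invMg sreflV -/(wmul _ _) leqNgt -len_ldesc /ldesc invgK E0 E1.
  by rewrite -leqNgt.
move=> le; apply: leq_trans le; move: ab; rewrite leq_eqVlt => /orP[/eqP E|ab].
  by rewrite (_ : a = Ordinal ltb') //; apply: val_inj.
by apply: IH; rewrite ?Ec'.
Qed.

Lemma minrep_ex w : exists2 u, u \in wstab c & wmul w u \in minrep (wstab c).
Proof.
case: (@arg_minnP _ 1%g (mem (wstab c)) (fun u => len (wmul w u)) (wstab1 c)).
move=> u Su min; exists u => //; rewrite inE; apply/forall_inP => u' Su'.
by rewrite -wmulA; apply: min; apply: wstabM.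
Qed.

Lemma minrep_uniq x u : blockinc x -> u \in wstab c ->
  blockinc (wmul x u) -> u = 1%g.
Proof.
move=> bx Su bxu; apply: len_eq0.
have := len_stab bxu (wstabV Su); rewrite -wmulA wmulV wmul1r len_stab //; lia.
Qed.

(** Multiplication by [w_0] reverses lengths, so minimality of [w_0 w] makes [w] longest in its
    coset, and its factor [u] longest in the stabilizer. *)
Lemma len_longest_stab w x u : blockinc (wmul w0 w) -> w = wmul x u ->
  blockinc x -> u \in wstab c -> len u = len (longest (wstab c)).
Proof.
move=> bw Ew bx Su.
have max z : z \in wstab c -> (len z <= len u)%N.
  move=> Sz; have Suz : wmul u^-1%g z \in wstab c by rewrite wstabM ?wstabV.
  have Ez : wmul (wmul w0 w) (wmul u^-1%g z) = wmul w0 (wmul x z).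
    by rewrite Ew -!wmulA (wmulA u) wmulV wmul1l.
  have := len_stab bw Suz; have := len_w0_mul w; have := len_w0_mul (wmul x z).
  by rewrite Ez Ew (len_stab bx Sz) (len_stab bx Su); lia.
apply/eqP; rewrite eqn_leq /longest; case: arg_maxnP => [|z Sz maxz].
  exact: wstab1.
by rewrite (max _ Sz) andbT; apply: (maxz _ Su).
Qed.

(** By [wstab_ldesc] every left descent met on the way down from an element of the stabilizer is one
    of the generators. *)
Lemma wpara_Jset : wpara (Jset c) = wstab c.
Proof.
apply/eqP; rewrite eqEsubset; apply/andP; split.
  have gS : group_set (wstab c).
    apply/group_setP; split=> [|w u Sw Su]; first exact: wstab1.
    exact: (wstabM Su Sw).
  rewrite /wpara (gen_subG _ (Group gS)); apply/subsetP => _ /imsetP[j Jj ->].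
  exact: Jset_stab.
apply/subsetP => u; move: u.
apply: perm_lind => [|i w nd IH Sw]; first by rewrite group1.
have d : ldesc i (wmul (srefl i) w) by rewrite ldesc_srefl.
have := wstab_srefl Sw d; rewrite wmul_sreflK => /IH Pw.
rewrite /wmul groupM //; apply: mem_gen; apply: imset_f.
exact: wstab_ldesc Sw d.
Qed.

Lemma dec_orbit x d : decreasing d -> wact x c = d -> d = c.
Proof.
move=> ddec; move: x; apply: perm_lind => [|i x nd IH E];
  first by rewrite wact1.
apply: IH; rewrite -[in RHS]E wactM.
suff Ei : wact x c (pos0 i) = wact x c (pos1 i).
  by rewrite wact_srefl Ei subrr mulr0z subr0.
have Ed k : d (srefl i k) = wact x c k by rewrite -E wactM wactE.
apply/le_anti/andP; split; last by rewrite !ffunE cdec // ltnW // -ldescN.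
by rewrite -!Ed srefl_pos0 srefl_pos1 ddec /=.
Qed.
End Stabilizer.

Lemma sort_ex d : exists x c, decreasing c /\ d = wact x c.
Proof.
pose s := [tuple d k | k < r].
have /tuple_permP[p Ep] : perm_eq (sort (fun a b : int => b <= a) s) s.
  by rewrite perm_sort.
pose c : weight r := [ffun k => tnth s (p k)].
have Ec (k : 'I_r) : c k = nth 0 (sort (fun a b : int => b <= a) s) k.
  by rewrite Ep -tnth_nth tnth_mktuple ffunE.
exists p, c; split=> [a b ab|]; last first.
  by apply/ffunP => k; rewrite !ffunE permKV tnth_mktuple.
rewrite !Ec; apply: (@sorted_leq_nth _ (fun a b : int => b <= a)) => //.
- by move=> x y z xy yz; apply: le_trans yz xy.
- by apply: sort_sorted => x y; apply: le_total.
- by rewrite inE size_sort size_tuple.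
by rewrite inE size_sort size_tuple.
Qed.

(** * The scalars h along the weak order *)

Section Hfac.
Variables (F : fieldType) (q : F) (g : int -> F).

Lemma hfac1 c : hfac q g c 1%g = 1.
Proof.
rewrite /hfac len1 expr0 mul1r big1 // => p; rewrite !perm1; lia.
Qed.

Lemma hfac_srefl c i w : ~~ ldesc i w -> hfac q g c (wmul (srefl i) w) =
  - q * g (- (c (w^-1%g (pos0 i)) - c (w^-1%g (pos1 i)))) * hfac q g c w.
Proof.
move=> nd; rewrite /hfac len_srefl // exprS -!mulrA; congr (_ * _).
have E u : \prod_(p : 'I_r * 'I_r | (p.1 < p.2)%N && (u p.2 < u p.1)%N)
    g (- (c p.1 - c p.2)) = \prod_(p in invset u) g (- (c p.1 - c p.2)).
  by apply: eq_bigl => p; rewrite inE.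
by rewrite !E invset_srefl // big_setU1 ?invset_notin //= mulrCA.
Qed.

(** An inversion inside a block contributes [-q * g 0 = q]. The letters of [x] only see entries of
    [c], which [u] leaves unchanged. *)
Lemma hfac_stab c x u : decreasing c -> g 0 = -1 ->
  blockinc c x -> u \in wstab c ->
  hfac q g c (wmul x u) = hfac q g c x * q ^+ len u.
Proof.
move=> cdec g0 bx Su; move: x bx; apply: perm_lind => [_|i x nd IH bx].
  rewrite wmul1l hfac1 mul1r; move: u Su.
  apply: perm_lind => [_|i w nd IH Sw]; first by rewrite hfac1 len1.
  have d : ldesc i (wmul (srefl i) w) by rewrite ldesc_srefl.
  have Sw' : w \in wstab c by rewrite -(wmul_sreflK i w) wstab_srefl.
  have := wstab_ldesc cdec Sw d; rewrite inE => /eqP Ei.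
  rewrite hfac_srefl // IH // len_srefl // !(wstabE _ (wstabV Sw')) Ei.
  by rewrite subrr oppr0 g0 mulrN1 opprK exprS.
have [bx' _] := blockinc_step cdec nd bx.
rewrite -wmulA !hfac_srefl ?(stab_step cdec nd bx) // IH // !mulrA.
by rewrite /wmul invMg !permM !(wstabE _ (wstabV Su)).
Qed.

Lemma hfac_neq0 c w : q != 0 -> (forall k, g k != 0) -> hfac q g c w != 0.
Proof.
move=> q0 gu; rewrite mulf_neq0 ?expf_neq0 ?oppr_eq0 //.
by apply/prodf_neq0 => p _.
Qed.
End Hfac.
End Combinatorics.

(** * Laurent polynomials and divided differences *)

Section Laurent.
Variables (F : fieldType) (r : nat).
Implicit Types (w x y u z : 'S_r) (i j : 'I_r.-1) (a b : weight r).
Implicit Types (f h m : laurent F r).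

Section MonomialMaps.
Variable h : weight r -> weight r.
Hypothesis hD : {morph h : a b / a + b}.
Let mon : laurent F r -> laurent F r := lext (fun a => ypow (h a)).

Lemma mon_mul f k : mon (f * k) = mon f * mon k.
Proof.
move: f; apply: linear_ypow_eq => [c f1 f2|c f1 f2|a].
- by rewrite mulrDl -scalerAl /mon linearP.
- by rewrite /mon linearP mulrDl -scalerAl.
move: k; apply: linear_ypow_eq => [c f1 f2|c f1 f2|b].
- by rewrite mulrDr -scalerAr /mon linearP.
- by rewrite /mon linearP mulrDr -scalerAr.
by rewrite -ypowD /mon !lext_ypow hD ypowD.
Qed.

Lemma mon1 : mon 1 = 1.
Proof.
rewrite -ypow0 /mon lext_ypow; congr (ypow _); apply: (addrI (h 0)).
by rewrite -hD !addr0.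
Qed.
End MonomialMaps.

Lemma wactD w a b : wact w (a + b) = wact w a + wact w b.
Proof. by apply/ffunP => k; rewrite !ffunE. Qed.

Lemma wactN w a : wact w (- a) = - wact w a.
Proof. by apply/ffunP => k; rewrite !ffunE. Qed.

Lemma wactMn w a n : wact w (a *+ n) = wact w a *+ n.
Proof. by apply/ffunP => k; rewrite !ffunE !ffunMnE ffunE. Qed.

Lemma lact_linear w : linear (@lact F r w).
Proof. by move=> c f k; rewrite /lact linearP. Qed.

Lemma lactU w a : lact w (ypow a) = ypow (wact w a) :> laurent F r.
Proof. exact: lext_ypow. Qed.

Lemma lactMul w f k : lact w (f * k) = lact w f * lact w k.
Proof. exact: (mon_mul (wactD w)). Qed.

Lemma lact1 w : lact w 1 = 1 :> laurent F r.
Proof. exact: (mon1 (wactD w)). Qed.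

Lemma lactB w f k : lact w (f - k) = lact w f - lact w k.
Proof. exact: (linB (lact_linear w)). Qed.

Lemma lactZ w c f : lact w (c *: f) = c *: lact w f.
Proof. exact: (linZ (lact_linear w)). Qed.

Lemma lactM w u f : lact (wmul w u) f = lact w (lact u f).
Proof.
move: f; apply: linear_ypow_eq => [|c f1 f2|a]; first exact: lact_linear.
  by rewrite !lact_linear.
by rewrite !lactU wactM.
Qed.

Lemma lact_id f : lact 1%g f = f.
Proof.
move: f; apply: linear_ypow_eq => [|//|a]; first exact: lact_linear.
by rewrite lactU wact1.
Qed.

Lemma lact_sreflK i : involutive (@lact F r (srefl i)).
Proof. by move=> f; rewrite -lactM /wmul sreflK lact_id. Qed.

Lemma lact_w0K : involutive (@lact F r (w0 r)).
Proof. by move=> f; rewrite -lactM -[wmul _ _]wmul1r -wmulA wmul_w0K lact_id.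
  Qed.

Lemma iota_linear : linear (@iota_y F r).
Proof. by move=> c f k; rewrite /iota_y linearP. Qed.

Lemma iotaU a : iota_y (ypow a) = ypow (- a) :> laurent F r.
Proof. exact: lext_ypow. Qed.

Lemma iotaM f k : iota_y (f * k) = iota_y f * iota_y k.
Proof. by apply: mon_mul => a b; rewrite opprD. Qed.

Lemma iota1 : iota_y 1 = 1 :> laurent F r.
Proof. by apply: mon1 => a b; rewrite opprD. Qed.

Lemma iotaK : involutive (@iota_y F r).
Proof.
apply: linear_ypow_eq => [c f1 f2|//|a]; first by rewrite !iota_linear.
by rewrite !iotaU opprK.
Qed.

Section Subst.
Variable n : nat.
Let sp : laurent F r -> laurent F r := subst_pow n.

Lemma sp_linear : linear sp.
Proof. by move=> c f k; rewrite /sp /subst_pow linearP. Qed.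

Lemma spU a : sp (ypow a) = ypow (a *+ n).
Proof. exact: lext_ypow. Qed.

Lemma spM f k : sp (f * k) = sp f * sp k.
Proof. by apply: mon_mul => a b; rewrite mulrnDl. Qed.

Lemma sp1 : sp 1 = 1.
Proof. by apply: mon1 => a b; rewrite mulrnDl. Qed.

End Subst.

Lemma mcoeff_mulU f a b : mcoeff a (f * ypow b) = mcoeff (a - b) f.
Proof.
move: f; apply: (@linear_ypow_eq F r F^o) => [c f1 f2|c f1 f2|k].
- by rewrite mulrDl -scalerAl lcoeffP.
- by rewrite lcoeffP.
by rewrite -ypowD !ypowE !mcoeffU [_ == a](_ : _ = (k == a - b)) //
  [RHS]eq_sym subr_eq eq_sym.
Qed.

(** From [f = f y^b] the coefficients are periodic along [b], against finite support. This provides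
    cancellation of the denominators [1 - y^b]. *)
Lemma mul_1subU_eq0 b f : b != 0 -> f * (1 - ypow b) = 0 -> f = 0.
Proof.
move=> b0; rewrite mulrBr mulr1 => /eqP; rewrite subr_eq0 => /eqP E.
have per k p : mcoeff (k - b *+ p) f = mcoeff k f.
  elim: p => [|p IH]; first by rewrite subr0.
  by rewrite -[in RHS]IH [in RHS]E mcoeff_mulU mulrSr opprD addrA.
apply/malgP => k; rewrite lcoeff0; apply/eqP/negPn/negP => nz.
(* One more translate of [k] than the support has elements. *)
pose s := [seq k - b *+ p | p <- iota 0 (size (msupp f)).+1].
have us : uniq s.
  rewrite map_inj_uniq ?iota_uniq // => p p' /addrI/oppr_inj.
  have [t bt] : exists t, b t != 0.
    apply/existsP; apply: contraNT b0 => /existsPn nb; apply/eqP/ffunP => t.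
    by apply/eqP; rewrite ffunE; have := nb t; rewrite negbK.
  by move/(congr1 (fun d : weight r => d t)); rewrite !ffunMnE => /(mulrIn bt).
have sub : {subset s <= msupp f}.
  by move=> _ /mapP[p _ ->]; rewrite -mcoeff_neq0 per.
by have := uniq_leq_size us sub; rewrite size_map size_iota ltnn.
Qed.

Lemma mul_1subU_inj b f k : b != 0 ->
  f * (1 - ypow b) = k * (1 - ypow b) -> f = k.
Proof.
move=> b0 /eqP; rewrite -subr_eq0 -mulrBl => /eqP /(mul_1subU_eq0 b0) /eqP.
by rewrite subr_eq0 => /eqP.
Qed.

Lemma alpha_pos0 i : alpha i (pos0 i) = 1.
Proof. by rewrite ffunE eqxx pos01 subr0. Qed.

Lemma alpha_pos1 i : alpha i (pos1 i) = -1.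
Proof. by rewrite ffunE eqxx eq_sym pos01 sub0r. Qed.

Lemma alpha_neq0 i : alpha i != 0.
Proof.
by apply/eqP => /ffunP/(_ (pos0 i)) /eqP; rewrite alpha_pos0 ffunE oner_eq0.
Qed.

(** With the denominator [1 - y^alpha] the operator is idempotent ([ddiff_idem]), and its twisted
    Leibniz rule [ddiffM] has the shape of the Bernstein relation. *)
Definition ddiff i f : laurent F r :=
  ldiv (f - lact (srefl i) f) (1 - ypow (alpha i)).

Lemma ddiffK i f : ddiff i f * (1 - ypow (alpha i)) = f - lact (srefl i) f.
Proof.
(* [demW_dvd] at the junk value [q = 0], where [q ^- 2 = 0]. *)
apply: ldivK; have [k Ek] := demW_dvd 0 i f; exists (- k - lact (srefl i) f).
rewrite expr0n /= invr0 scale0r subr0 sub0r scaleN1r in Ek.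
rewrite mulrBl mulNr Ek; ring.
Qed.

Lemma ddiff_uniq i f k :
  k * (1 - ypow (alpha i)) = f - lact (srefl i) f -> ddiff i f = k.
Proof. by rewrite -ddiffK => /(mul_1subU_inj (alpha_neq0 i)). Qed.

Lemma ddiff_linear i : linear (ddiff i).
Proof.
move=> c f k; apply: ddiff_uniq.
by rewrite mulrDl -scalerAl !ddiffK lact_linear scalerBr opprD addrACA.
Qed.

Lemma ddiffM i f k :
  ddiff i (f * k) = lact (srefl i) f * ddiff i k + ddiff i f * k.
Proof.
apply: ddiff_uniq; rewrite mulrDl -mulrA ddiffK mulrAC ddiffK lactMul.
ring.
Qed.

Lemma wact_alpha i : wact (srefl i) (alpha i) = - alpha i.
Proof.
by rewrite wact_srefl alpha_pos0 alpha_pos1 opprK mulrzDr mulr1z opprD addrA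
  subrr sub0r.
Qed.

Lemma lact_ddiff i f : lact (srefl i) (ddiff i f) = ypow (alpha i) * ddiff i f.
Proof.
apply: (mul_1subU_inj (alpha_neq0 i)).
have := congr1 (lact (srefl i)) (ddiffK i f).
rewrite lactMul !lactB lact1 lactU wact_alpha lact_sreflK -mulrA ddiffK => E.
have U : ypow (alpha i) * ypow (- alpha i) = 1 :> laurent F r.
  by rewrite -ypowD subrr ypow0.
have := congr1 (fun k => ypow (alpha i) * k) E; rewrite /= => E2.
transitivity (- (ypow (alpha i) * (lact (srefl i) (ddiff i f) * (1 - ypow (-
  alpha i))))).
  transitivity (lact (srefl i) (ddiff i f) * (ypow (alpha i) * ypow (- alpha
    i) - ypow (alpha i))); [by rewrite U|ring].
rewrite E2; ring.
Qed.

Lemma ddiff_sym i f : lact (srefl i) f = f -> ddiff i f = 0.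
Proof. by move=> E; apply: ddiff_uniq; rewrite E subrr mul0r. Qed.

Lemma ddiff_srefl i f : ddiff i (lact (srefl i) f) = - ddiff i f.
Proof.
by apply: ddiff_uniq; rewrite mulNr ddiffK lact_sreflK opprB.
Qed.
End Laurent.

(** * Braid identities for divided differences *)

Section DividedDifferences.
Variables (F : fieldType) (r : nat).
Implicit Types (w : 'S_r) (i j : 'I_r.-1) (f : laurent F r).
Local Notation s i := (@lact F r (srefl i)).
Local Notation N i := (@ddiff F r i).
Local Notation Y i := (ypow (alpha i) : laurent F r).

Lemma ddiff_idem i f : N i (N i f) = N i f.
Proof. by apply: ddiff_uniq; rewrite lact_ddiff mulrBr mulr1 mulrC. Qed.

Lemma wact_alphaE w i k : wact w (alpha i) k =
  (k == w (pos0 i))%:Z - (k == w (pos1 i))%:Z.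
Proof. by rewrite !ffunE !(can2_eq (permKV w) (permK w)). Qed.

(** [w] carries [alpha i] to [alpha j] and conjugates [s_i] into [s_j], hence carries one defining
    equation to the other. *)
Lemma lact_ddiff_conj w i j f : w (pos0 i) = pos0 j -> w (pos1 i) = pos1 j ->
  lact w (N i f) = N j (lact w f).
Proof.
move=> E0 E1; apply/esym/ddiff_uniq; have := congr1 (lact w) (ddiffK i f).
rewrite lactMul !lactB lact1 lactU -!lactM.
have -> : wact w (alpha i) = alpha j.
  by apply/ffunP => k; rewrite wact_alphaE E0 E1 !ffunE.
suff -> : wmul w (srefl i) = wmul (srefl j) w by [].
by rewrite /wmul /srefl -E0 -E1 -tpermJ conjgE mulKVg.
Qed.

Lemma lact_ddiff_conjN w i j f : w (pos0 i) = pos1 j -> w (pos1 i) = pos0 j ->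
  lact w (s i (N i f)) = - N j (lact w f).
Proof.
move=> E0 E1; rewrite -ddiff_srefl -!lactM.
rewrite (@lact_ddiff_conj (wmul w (srefl i)) i j) /wmul ?permM ?srefl_pos0
  ?srefl_pos1 //.
by rewrite /srefl [tperm (pos0 j) _]tpermC -E0 -E1 -tpermJ conjgE mulKVg.
Qed.

Section Far.
Variables i j : 'I_r.-1.
Hypothesis ij : (i.+1 < j)%N.

Lemma far_fix k : k = pos0 i \/ k = pos1 i -> srefl j k = k.
Proof. by case=> ->; rewrite tpermD // -val_eqE /=; lia. Qed.

Lemma far_fix' k : k = pos0 j \/ k = pos1 j -> srefl i k = k.
Proof. by case=> ->; rewrite tpermD // -val_eqE /=; lia. Qed.

Lemma far_sreflC : (srefl i * srefl j = srefl j * srefl i)%g.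
Proof.
have E : (srefl i ^ srefl j = srefl i)%g.
  by rewrite tpermJ !far_fix; auto.
by rewrite -{1}E conjgE sreflV mulgA -!mulgA sreflK mulg1.
Qed.

Lemma far_lact f : s i (s j f) = s j (s i f).
Proof. by rewrite -!lactM /wmul far_sreflC. Qed.

Lemma far_lact_ddiff f : s i (N j f) = N j (s i f).
Proof. by apply: lact_ddiff_conj; rewrite far_fix'; auto. Qed.

Lemma far_lact_ddiff' f : s j (N i f) = N i (s j f).
Proof. by apply: lact_ddiff_conj; rewrite far_fix; auto. Qed.

Lemma far_ddiff f : N i (N j f) = N j (N i f).
Proof.
apply: (mul_1subU_inj (alpha_neq0 i)); rewrite ddiffK far_lact_ddiff.
apply: (mul_1subU_inj (alpha_neq0 j)).
rewrite mulrBl !ddiffK mulrAC ddiffK mulrBl ddiffK far_lact_ddiff' ddiffK.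
rewrite far_lact; ring.
Qed.
End Far.

Section NearIdentity.
Variables (i j : 'I_r.-1).
Let a := Y i. Let b := Y j.
Hypothesis near_lact : forall f, s i (s j (s i f)) = s j (s i (s j f)).
Hypothesis near_lact_ddiff : forall f, s i (s j (N i f)) = N j (s i (s j f)).
Hypothesis near_lact_ddiff' : forall f, s j (s i (N j f)) = N i (s j (s i f)).
Hypothesis siN : forall f,
  s i (N j f) * (1 - a * b) = s i f - s i (s j f).
Hypothesis sjN : forall f,
  s j (N i f) * (1 - a * b) = s j f - s j (s i f).
Hypothesis cancel : forall f k,
  (f - k) * ((1 - a) * (1 - b) * (1 - a * b)) = 0 -> f = k.

(** The identity between the coefficients of [K_i m] in the braid relation ([near_comb]). The
    hypotheses are listed in place of [j = i + 1], so that exchanging [i] and [j] gives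
    [near_mixed']. *)
Lemma mixed_identity f :
  s i (N j (s i f)) + N i (N j (s i f)) + s i (N j (N i f)) = N j (s i (N j f)).
Proof.
apply: cancel.
have h1 := siN (s i f); have h2 := ddiffK j (s i f).
have h3 := ddiffK i (N j (s i f)); have h4 := ddiffK i f.
have h5 := ddiffK j (s i (s j f)); have h6 := siN (N i f).
have h7 := siN f; have h8 := ddiffK i (s j (s i f)).
have h9 := ddiffK j (s i (N j f)).
rewrite near_lact_ddiff lact_ddiff in h6.
rewrite near_lact_ddiff' in h9.
rewrite near_lact lact_sreflK in h1.
rewrite [s i (s j (s i f))]near_lact in h8.
move: h1 h2 h3 h4 h5 h6 h7 h8 h9; rewrite -/a -/b.
set T1 := s i (N j (s i f)); set T2 := N i (N j (s i f)).
set T3 := s i (N j (N i f)); set R := N j (s i (N j f)).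
set p := N j (s i f); set x := N i f; set z := N j (s i (s j f)).
set y := s i (N j f); set u := N i (s j (s i f)).
set f1 := s i f; set f21 := s j f1; set f12 := s i (s j f).
set f121 := s j f12 => h1 h2 h3 h4 h5 h6 h7 h8 h9.
(* Each bracket vanishes by one of [h1] to [h9]. The cofactors come from eliminating the divided
   differences one at a time, after which the translates of [f] cancel. *)
transitivity ((1 - a) * (1 - b) * (T1 * (1 - a * b) - (f - f121))
  + (1 - b) * (1 - a * b) * (T2 * (1 - a) - (p - T1))
  + (1 - a * b) * (p * (1 - b) - (f1 - f21))
  - (1 - b) * (T1 * (1 - a * b) - (f - f121))
  + (1 - a) * (1 - b) * (T3 * (1 - a * b) - (a * x - z))
  + a * (1 - b) * (x * (1 - a) - (f - f1))
  - (1 - a) * (z * (1 - b) - (f12 - f121))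
  - (1 - a) * (1 - a * b) * (R * (1 - b) - (y - u))
  - (1 - a) * (y * (1 - a * b) - (f1 - f12))
  + (1 - a * b) * (u * (1 - a) - (f21 - f121))); first by ring.
rewrite h1 h2 h3 h4 h5 h6 h7 h8 h9; ring.
Qed.

(** The triple divided difference is the antisymmetrization over the copy of [S_3] divided by the
    product over its positive roots. This is symmetric in [i] and [j], whence [near_ddiff]. *)
Lemma antisym_formula f : N i (N j (N i f)) * ((1 - a) * (1 - b) * (1 - a *
  b)) =
  f - s i f - s j f + s j (s i f) + s i (s j f) - s i (s j (s i f)).
Proof.
apply: (mul_1subU_inj (alpha_neq0 i)).
have h1 := ddiffK i (N j (N i f)); have h2 := ddiffK j (N i f).
have h3 := ddiffK i f; have h4 := ddiffK j (s i (s j f)); have h5 :=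
  siN (N i f).
have h6 := sjN f.
rewrite near_lact_ddiff lact_ddiff in h5; rewrite near_lact.
move: h1 h2 h3 h4 h5 h6; rewrite -/a -/b.
set T := N i (N j (N i f)); set t := s i (N j (N i f)); set p := N j (N i f).
set x := N i f; set z := N j (s i (s j f)); set y := s j x.
set f1 := s i f; set f2 := s j f; set f21 := s j f1; set f12 := s i f2.
set f121 := s j f12 => h1 h2 h3 h4 h5 h6.
apply/subr0_eq.
transitivity ((1 - a) * (1 - b) * (1 - a * b) * (T * (1 - a) - (p - t))
  + (1 - a) * (1 - a * b) * (p * (1 - b) - (x - y))
  - (1 - a) * (1 - b) * (t * (1 - a * b) - (a * x - z))
  + (1 - a * b - a * (1 - b)) * (x * (1 - a) - (f - f1))
  - (1 - a) * (y * (1 - a * b) - (f2 - f21))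
  + (1 - a) * (z * (1 - b) - (f12 - f121))); first by ring.
rewrite h1 h2 h3 h4 h5 h6; ring.
Qed.
End NearIdentity.

Section Near.
Variables i j : 'I_r.-1.
Hypothesis ij : j = i.+1 :> nat.

Let p1 : pos1 i = pos0 j. Proof. exact: val_inj. Qed.
Let n0 : srefl j (pos0 i) = pos0 i.
Proof. by rewrite tpermD // -val_eqE /=; lia. Qed.
Let n1 : srefl i (pos1 j) = pos1 j.
Proof. by rewrite tpermD // -val_eqE /=; lia. Qed.
Lemma near_braid :
  (srefl i * (srefl j * srefl i) = srefl j * (srefl i * srefl j))%g.
Proof.
have Ei : (srefl i * (srefl j * srefl i) = srefl j ^ srefl i)%g.
  by rewrite conjgE sreflV.
have Ej : (srefl j * (srefl i * srefl j) = srefl i ^ srefl j)%g.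
  by rewrite conjgE sreflV.
by rewrite Ei Ej !tpermJ n0 n1 -p1 srefl_pos1 p1 srefl_pos0.
Qed.

Lemma near_lact f : s i (s j (s i f)) = s j (s i (s j f)).
Proof. by rewrite -!lactM /wmul near_braid. Qed.

Lemma near_lact_ddiff f : s i (s j (N i f)) = N j (s i (s j f)).
Proof.
rewrite -!lactM; apply: lact_ddiff_conj; rewrite /wmul permM.
  by rewrite n0 srefl_pos0.
by rewrite p1 srefl_pos0 n1.
Qed.

Lemma near_lact_ddiff' f : s j (s i (N j f)) = N i (s j (s i f)).
Proof.
rewrite -!lactM; apply: lact_ddiff_conj; rewrite /wmul permM.
  by rewrite -p1 srefl_pos1 n0.
by rewrite n1 srefl_pos1.
Qed.

Let a := Y i. Let b := Y j.

Let sia : wact (srefl i) (alpha j) = alpha i + alpha j.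
Proof.
apply/ffunP => k; rewrite wact_alphaE n1 -p1 srefl_pos1 !ffunE -p1.
by rewrite addrA addrNK.
Qed.

Let sja : wact (srefl j) (alpha i) = alpha i + alpha j.
Proof.
apply/ffunP => k; rewrite wact_alphaE n0 p1 srefl_pos0 !ffunE p1.
by rewrite addrA addrNK.
Qed.

Let ab_neq0 : alpha i + alpha j != 0.
Proof.
rewrite -sia; apply/eqP => /(congr1 (wact (srefl i))).
rewrite -wactM /wmul sreflK wact1 => E.
by have /eqP := alpha_neq0 j; apply; rewrite E; apply/ffunP => k;
  rewrite !ffunE.
Qed.

Let siN f : s i (N j f) * (1 - a * b) = s i f - s i (s j f).
Proof.
have := congr1 (s i) (ddiffK j f).
by rewrite lactMul !lactB lact1 lactU sia ypowD.
Qed.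

Let sjN f : s j (N i f) * (1 - a * b) = s j f - s j (s i f).
Proof.
have := congr1 (s j) (ddiffK i f).
by rewrite lactMul !lactB lact1 lactU sja ypowD.
Qed.

Let cancel f k : (f - k) * ((1 - a) * (1 - b) * (1 - a * b)) = 0 -> f = k.
Proof.
rewrite mulrA -ypowD => /(mul_1subU_eq0 ab_neq0); rewrite mulrA.
by move=> /(mul_1subU_eq0 (alpha_neq0 j)) /(mul_1subU_eq0 (alpha_neq0 i))
  /subr0_eq.
Qed.

(** Both sides are the divided difference along the root [alpha i + alpha j]. *)
Lemma near_siNsi f : s i (N j (s i f)) = s j (N i (s j f)).
Proof.
apply: cancel; set X := s i _; set Z := s j _.
transitivity ((X * (1 - a * b) - Z * (1 - a * b)) * ((1 - a) * (1 - b))).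
  ring.
by rewrite siN sjN near_lact !lact_sreflK subrr mul0r.
Qed.

Lemma near_mixed f :
  s i (N j (s i f)) + N i (N j (s i f)) + s i (N j (N i f)) = N j (s i (N j f)).
Proof.
exact: (mixed_identity near_lact near_lact_ddiff near_lact_ddiff' siN cancel).
Qed.

Let siN' f : s i (N j f) * (1 - b * a) = s i f - s i (s j f).
Proof. by rewrite [b * a]mulrC; exact: siN. Qed.

Let sjN' f : s j (N i f) * (1 - b * a) = s j f - s j (s i f).
Proof. by rewrite [b * a]mulrC; exact: sjN. Qed.

Let cancel' f k : (f - k) * ((1 - b) * (1 - a) * (1 - b * a)) = 0 -> f = k.
Proof. by rewrite [(1 - b) * _]mulrC [b * a]mulrC; exact: cancel. Qed.

Let near_lact' f : s j (s i (s j f)) = s i (s j (s i f)).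
Proof. by rewrite near_lact. Qed.

Lemma near_mixed' f :
  s j (N i (s j f)) + N j (N i (s j f)) + s j (N i (N j f)) = N i (s j (N i f)).
Proof.
exact: (mixed_identity near_lact' near_lact_ddiff' near_lact_ddiff sjN'
  cancel').
Qed.

Lemma near_ddiff f : N i (N j (N i f)) = N j (N i (N j f)).
Proof.
apply: cancel; rewrite mulrBl.
rewrite (antisym_formula near_lact near_lact_ddiff siN sjN).
rewrite [(1 - a) * _]mulrC [a * b]mulrC.
rewrite (antisym_formula near_lact' near_lact_ddiff' sjN' siN').
rewrite near_lact; ring.
Qed.
End Near.
End DividedDifferences.

(** * Bernstein relations *)

Section Bernstein.
Variables (F : fieldType) (r : nat) (v : F).
Implicit Types (w : 'S_r) (i j : 'I_r.-1) (f e : laurent F r).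
Local Notation s i := (@lact F r (srefl i)).
Local Notation N i := (@ddiff F r i).

Variables (V : zmodType) (act : laurent F r -> V -> V).
Hypothesis actDl : forall f e m, act (f + e) m = act f m + act e m.
Hypothesis actDr : forall f m p, act f (m + p) = act f m + act f p.
Hypothesis actA : forall f e m, act (f * e) m = act f (act e m).

Variable K : 'I_r.-1 -> V -> V.
Hypothesis KD : forall i m p, K i (m + p) = K i m + K i p.

Let c : laurent F r := (v - 1)%:A.
Hypothesis Kact : forall i f m,
  K i (act f m) = act (s i f) (K i m) + act (c * N i f) m.

(** Stated at a single vector, because [quad_act] carries it from [m] to all [act f m]. *)
Definition quad_at i m := K i (K i m) = act c (K i m) + act v%:A m.

Let sc i f : s i (c * f) = c * s i f.
Proof. by rewrite lactMul /c lactZ lact1. Qed.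

Let Nc i f : N i (c * f) = c * N i f.
Proof. by rewrite /c !mulr_algl (linZ (ddiff_linear i)). Qed.

Let act0 m : act 0 m = 0.
Proof. by apply: (addrI (act 0 m)); rewrite -actDl !addr0. Qed.

Section Combinations.
Variables n1 n2 n3 n4 n5 n6 : V.
(** [V] is only an additive group, out of reach of [ring]. Formal combinations of six fixed vectors
    collect the coefficients, and [congr L] leaves identities between Laurent polynomials. *)
Let L e1 e2 e3 e4 e5 e6 := act e1 n1 + act e2 n2 + act e3 n3
  + (act e4 n4 + act e5 n5 + act e6 n6).

Let LD e1 e2 e3 e4 e5 e6 f1 f2 f3 f4 f5 f6 :
  L e1 e2 e3 e4 e5 e6 + L f1 f2 f3 f4 f5 f6 =
  L (e1 + f1) (e2 + f2) (e3 + f3) (e4 + f4) (e5 + f5) (e6 + f6).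
Proof. by rewrite /L !actDl addrACA; congr (_ + _); rewrite addrACA;
  congr (_ + _); rewrite addrACA. Qed.

Let L1 e : act e n1 = L e 0 0 0 0 0. Proof. by rewrite /L !act0 ?(addr0,
  add0r). Qed.
Let L2 e : act e n2 = L 0 e 0 0 0 0. Proof. by rewrite /L !act0 ?(addr0,
  add0r). Qed.
Let L3 e : act e n3 = L 0 0 e 0 0 0. Proof. by rewrite /L !act0 ?(addr0,
  add0r). Qed.
Let L4 e : act e n4 = L 0 0 0 e 0 0. Proof. by rewrite /L !act0 ?(addr0,
  add0r). Qed.
Let L5 e : act e n5 = L 0 0 0 0 e 0. Proof. by rewrite /L !act0 ?(addr0,
  add0r). Qed.
Let L6 e : act e n6 = L 0 0 0 0 0 e. Proof. by rewrite /L !act0 ?(addr0,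
  add0r). Qed.

Lemma quad_comb i f m : n1 = K i m -> n2 = m ->
  quad_at i m -> quad_at i (act f m).
Proof.
move=> E1 E2; rewrite /quad_at !(Kact, KD) => ->.
rewrite !actDr -!actA -E1 -E2 !(L1, L2) !LD; congr L; try ring.
  rewrite sc lact_ddiff ddiff_srefl lact_sreflK.
  have E := ddiffK i f.
  have -> : s i f = f - N i f * (1 - ypow (alpha i)) by rewrite E; ring.
  ring.
rewrite !Nc ddiff_idem lact_sreflK /c.
have -> : v%:A = (v - 1)%:A + 1 :> laurent F r by rewrite scalerBl scale1r
  subrK.
ring.
Qed.

Lemma far_comb i j f m : (i.+1 < j)%N ->
  n1 = K i (K j m) -> n2 = K i m -> n3 = K j m -> n4 = m ->
  K i (K j m) = K j (K i m) ->
  K i (K j (act f m)) = K j (K i (act f m)).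
Proof.
move=> ij E1 E2 E3 E4 E; rewrite !(Kact, KD) -E -E1 -E2 -E3 -E4.
rewrite !(L1, L2, L3, L4) !LD !(sc, Nc); congr L; try ring.
- by rewrite far_lact.
- by rewrite far_lact_ddiff //; ring.
- by rewrite far_lact_ddiff' //; ring.
by rewrite far_ddiff //; ring.
Qed.

(** Moving [f] through three operators produces [K_i K_i m] and [K_j K_j m], which is where the
    quadratic relations enter. The six coefficients then match by the identities for [s] and [N]. *)
Lemma near_comb i j f m : j = i.+1 :> nat ->
  n1 = K i (K j (K i m)) -> n2 = K i (K j m) -> n3 = K j (K i m) ->
  n4 = K i m -> n5 = K j m -> n6 = m ->
  quad_at i m -> quad_at j m ->
  K i (K j (K i m)) = K j (K i (K j m)) ->
  K i (K j (K i (act f m))) = K j (K i (K j (act f m))).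
Proof.
rewrite /quad_at => ij E1 E2 E3 E4 E5 E6 qi qj E.
rewrite !(Kact, KD) -E qi qj !actDr -!actA -E1 -E2 -E3 -E4 -E5 -E6.
rewrite !(L1, L2, L3, L4, L5, L6) !LD !(sc, Nc); congr L; try ring.
- by rewrite near_lact.
- by rewrite near_lact_ddiff //; ring.
- by rewrite near_lact_ddiff' //; ring.
- by rewrite -(near_mixed ij); ring.
- by rewrite -(near_mixed' ij); ring.
by rewrite near_siNsi // near_ddiff //; ring.
Qed.
End Combinations.

Lemma quad_act i f m : quad_at i m -> quad_at i (act f m).
Proof. exact: (@quad_comb (K i m) m 0 0 0 0). Qed.

Lemma far_act i j f m : (i.+1 < j)%N -> K i (K j m) = K j (K i m) ->
  K i (K j (act f m)) = K j (K i (act f m)).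
Proof. by move=> ij; exact: (@far_comb _ _ _ _ 0 0). Qed.

Lemma near_act i j f m : j = i.+1 :> nat -> quad_at i m -> quad_at j m ->
  K i (K j (K i m)) = K j (K i (K j m)) ->
  K i (K j (K i (act f m))) = K j (K i (K j (act f m))).
Proof. by move=> ij; exact: (@near_comb _ _ _ _ _ _). Qed.
End Bernstein.

(** * The Demazure-Whittaker operators and the regular Hecke module *)

Section HeckeModule.
Variables (F : fieldType) (r : nat) (q : F).
Implicit Types (w x y u z : 'S_r) (i j : 'I_r.-1) (f g : laurent F r).
Local Notation s i := (@lact F r (srefl i)).
Local Notation N i := (@ddiff F r i).
Local Notation U := (demW q).
Local Notation W0 := (w0 r).

(** Scalars as ring elements: after rewriting with [cstR], identities involving [*:] can be left to
    [ring]. *)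
Definition cst (c : F) : laurent F r := c%:A.

Lemma cstE c f : c *: f = cst c * f. Proof. by rewrite /cst mulr_algl. Qed.
Lemma cst_alg c : c%:A = cst c :> laurent F r. Proof. by []. Qed.
Lemma cst1 : cst 1 = 1. Proof. exact: scale1r. Qed.
Lemma cst0 : cst 0 = 0. Proof. exact: scale0r. Qed.
Lemma cstB c d : cst (c - d) = cst c - cst d. Proof. exact: scalerBl. Qed.
Lemma cstN c : cst (- c) = - cst c. Proof. exact: scaleNr. Qed.
Lemma cstM c d : cst (c * d) = cst c * cst d.
Proof. by rewrite /cst -[RHS]scalerAl mul1r scalerA. Qed.
Lemma cstX c n : cst (c ^+ n) = cst c ^+ n.
Proof. by elim: n => [|n IH]; rewrite ?cst1 // !exprS cstM IH. Qed.
Definition cstR := (cst_alg, cstE, cstB, cst0, cst1, cstN, cstM, cstX).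

(** Writing [y - q^-2 = -(1 - y) + (1 - q^-2)], with [y] the monomial of [alpha i], combines the two
    poles into one divided difference. *)
Lemma demWE i f : U i f = - s i f + (q ^- 2 - 1) *: N i f.
Proof.
apply: (mul_1subU_inj (alpha_neq0 i)); rewrite (ldivK (demW_dvd q i f)).
rewrite !cstR [RHS]mulrDl -mulrA ddiffK; ring.
Qed.

Lemma demW_linear i : linear (U i).
Proof.
move=> c f g; by rewrite !demWE lact_linear ddiff_linear !cstR; ring.
Qed.

Let mulact (f g : laurent F r) : laurent F r := f * g.

(** A Bernstein relation with parameter [q^-2]. Laurent polynomials are generated by [1], where
    every [U_i] is [-1], so the quadratic and braid relations are checked there. *)
Lemma demW_act i f g :
  U i (f * g) = s i f * U i g + ((q ^- 2 - 1)%:A * N i f) * g.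
Proof.
rewrite !demWE ddiffM lactMul !cstR; ring.
Qed.

Lemma demW1 i : U i 1 = -1.
Proof. by rewrite demWE lact1 ddiff_sym ?lact1 // scaler0 addr0. Qed.

Let UD i f g : U i (f + g) = U i f + U i g.
Proof. exact: (linD (demW_linear i)). Qed.

Lemma demW_quad i f : U i (U i f) = (q ^- 2 - 1) *: U i f + q ^- 2 *: f.
Proof.
rewrite [X in _ = X + _]cstE [X in _ = _ + X]cstE -[f]mulr1.
apply: (@quad_act F r (q ^- 2) _ mulact) => [||||i'|] //.
all: rewrite /mulact.
- exact: mulrDl.
- exact: mulrDr.
- by move=> *; rewrite mulrA.
- exact: demW_act.
rewrite /quad_at !(demW1, linN (demW_linear _)).
rewrite !cstR; ring.
Qed.

Lemma demW_far i j f : (i.+1 < j)%N -> U i (U j f) = U j (U i f).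
Proof.
move=> ij; rewrite -[f]mulr1; apply: (@far_act F r (q ^- 2) _ mulact) => //.
- exact: mulrDl.
- by move=> *; exact: demW_act.
by rewrite !(demW1, linN (demW_linear _)).
Qed.

Lemma demW_near i j f : j = i.+1 :> nat ->
  U i (U j (U i f)) = U j (U i (U j f)).
Proof.
have qd k : @quad_at F r (q ^- 2) _ mulact (demW q) k 1.
  rewrite /quad_at !(demW1, linN (demW_linear _)) /mulact.
  by rewrite !cstR; ring.
move=> ij; rewrite -[f]mulr1; apply: (@near_act F r (q ^- 2) _ mulact) => //.
- exact: mulrDl.
- exact: mulrDr.
- by move=> *; rewrite /mulact mulrA.
- by move=> *; exact: demW_act.
by rewrite !(demW1, linN (demW_linear _)).
Qed.

(** Free over the Laurent polynomials on the [hdelta x]; with the operators [hop_gen] it is the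
    affine Hecke algebra in its Bernstein form, under left multiplication. *)
Definition hmod : Type := {ffun 'S_r -> laurent F r}.
HB.instance Definition _ := GRing.Lmodule.on hmod.

Implicit Types (p : hmod).

Definition hact f p : hmod := [ffun x => f * p x].
Definition hdelta x : hmod := [ffun y => (y == x)%:R].

Local Notation v := (q ^+ 2).

(* The basis element [hdelta x] stands for the x-th standard basis vector of
   the finite Hecke algebra, rescaled so that left multiplication by the i-th
   generator sends it to [- q *: hdelta (s_i x)] if [s_i x] is longer than
     [x]. *)
Definition hop_gen i p : hmod := [ffun x =>
  - q *: s i (p (wmul (srefl i) x))
  + (v - 1) *: ((~~ ldesc i x)%:R * s i (p x) + N i (p x))].
Local Notation T := hop_gen.

Lemma hmodP p p' : (forall x, p x = p' x) -> p = p'.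
Proof. by move=> E; apply/ffunP. Qed.

Lemma hmodD p p' x : (p + p') x = p x + p' x. Proof. exact: ffunE. Qed.
Lemma hmodZ c p x : (c *: p) x = c *: p x. Proof. exact: ffunE. Qed.

Lemma hmod_sum (I : Type) (t : seq I) (P : pred I) (E : I -> hmod) x :
  (\sum_(k <- t | P k) E k) x = \sum_(k <- t | P k) E k x.
Proof. exact: (big_morph (fun p : hmod => p x) (fun p p' => hmodD p p' x)
  (ffunE _ x)). Qed.

Lemma hactE f p x : hact f p x = f * p x. Proof. exact: ffunE. Qed.
Lemma hdeltaE x y : hdelta x y = (y == x)%:R. Proof. exact: ffunE. Qed.
Lemma hop_genE i p x : T i p x = - q *: s i (p (wmul (srefl i) x))
  + (v - 1) *: ((~~ ldesc i x)%:R * s i (p x) + N i (p x)).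
Proof. exact: ffunE. Qed.

Lemma hop_gen_linear i : linear (T i).
Proof.
move=> c p p'; apply: hmodP => x.
rewrite !(hmodD, hmodZ, hop_genE) !lact_linear ddiff_linear !cstR; ring.
Qed.

Lemma hactDl f g p : hact (f + g) p = hact f p + hact g p.
Proof. by apply: hmodP => x; rewrite hmodD !hactE mulrDl. Qed.

Lemma hactDr f p p' : hact f (p + p') = hact f p + hact f p'.
Proof. by apply: hmodP => x; rewrite !(hmodD, hactE) mulrDr. Qed.

Lemma hactM f g p : hact (f * g) p = hact f (hact g p).
Proof. by apply: hmodP => x; rewrite !hactE mulrA. Qed.

Lemma hact_cst c p : hact c%:A p = c *: p.
Proof. by apply: hmodP => x; rewrite hmodZ hactE mulr_algl. Qed.

Lemma hmodE p : p = \sum_x hact (p x) (hdelta x).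
Proof.
apply: hmodP => x; rewrite hmod_sum (bigD1 x) //= hactE hdeltaE eqxx mulr1.
rewrite big1 ?addr0 // => y yx.
by rewrite hactE hdeltaE eq_sym (negPf yx) mulr0.
Qed.

Lemma hop_gen_act i f p :
  T i (hact f p) = hact (s i f) (T i p) + hact ((v - 1)%:A * N i f) p.
Proof.
apply: hmodP => x; rewrite !(hmodD, hactE, hop_genE) !lactMul ddiffM !cstR;
  ring.
Qed.

(** The diagonal term sits at the ascents: up to the factor [(-q)^l(x)], [hdelta x] behaves as the
    inverse of [T_{x^-1}]. *)
Lemma hop_gen_delta i x : T i (hdelta x) =
  - q *: hdelta (wmul (srefl i) x) + ((v - 1) *+ ~~ ldesc i x) *: hdelta x.
Proof.
have sb (b : bool) : s i b%:R = b%:R by case: b;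
  rewrite ?lact1 ?(lin0 (lact_linear _)).
apply: hmodP => y; rewrite hmodD !hmodZ hop_genE !hdeltaE !sb.
rewrite ddiff_sym ?sb // addr0.
have -> : (wmul (srefl i) y == x) = (y == wmul (srefl i) x).
  by rewrite -{2}(wmul_sreflK i y) (inj_eq (@wmul_inj _ _)).
congr (_ + _); have [->|_] := eqVneq y x; last by rewrite mulr0 !scaler0.
by rewrite mulr1; case: ldesc; rewrite ?scaler0 ?scale0r.
Qed.

Let TD i p p' : T i (p + p') = T i p + T i p'.
Proof. exact: (linD (hop_gen_linear i)). Qed.

Lemma hop_gen_ext (A B : hmod -> hmod) : linear A -> linear B ->
  (forall f x, A (hact f (hdelta x)) = B (hact f (hdelta x))) ->
    forall p, A p = B p.
Proof.
by move=> lA lB E p; rewrite [p]hmodE (lin_sum lA) (lin_sum lB); apply: eq_bigr.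
Qed.

Let Tcomp (A B : hmod -> hmod) : linear A -> linear B ->
  linear (fun p => A (B p)).
Proof. by move=> lA lB c p p'; rewrite lB lA. Qed.

Let TZ i c p : T i (c *: p) = c *: T i p.
Proof. exact: (linZ (hop_gen_linear i)). Qed.

Let Tdelta2 := (TD, TZ, hop_gen_delta).

Let quad_delta i x : quad_at (q ^+ 2) hact T i (hdelta x).
Proof.
rewrite /quad_at !hact_cst !Tdelta2 wmul_sreflK ldesc_srefl.
apply: hmodP => y; rewrite !(hmodD, hmodZ) !cstR; case: ldesc => /=;
rewrite ?mulr0n ?mulr1n !cstR ; ring.
Qed.

Lemma hop_gen_quad i p : T i (T i p) = (v - 1) *: T i p + v *: p.
Proof.
move: p; apply: hop_gen_ext => [||f x].
- exact: Tcomp (hop_gen_linear i) (hop_gen_linear i).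
- by move=> c p p'; rewrite hop_gen_linear !scalerDr !scalerA ![_ * c]mulrC
    addrACA.
rewrite -!hact_cst; apply: (@quad_act F r v _ hact hactDl hactDr hactM T TD)
  => //.
exact: hop_gen_act.
Qed.

Lemma hop_gen_far i j p : (i.+1 < j)%N -> T i (T j p) = T j (T i p).
Proof.
move=> ij; move: p; apply: hop_gen_ext => [||f x].
- exact: Tcomp (hop_gen_linear i) (hop_gen_linear j).
- exact: Tcomp (hop_gen_linear j) (hop_gen_linear i).
apply: (@far_act F r v _ hact hactDl T TD) => //; first exact: hop_gen_act.
rewrite !Tdelta2.
have -> : wmul (srefl i) (wmul (srefl j) x) = wmul (srefl j) (wmul (srefl i) x).
  by rewrite /wmul -!mulgA (far_sreflC ij).
have -> : ldesc i (wmul (srefl j) x) = ldesc i x.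
  by rewrite /ldesc !srefl_inv !(far_fix ij); auto.
have -> : ldesc j (wmul (srefl i) x) = ldesc j x.
  by rewrite /ldesc !srefl_inv !(far_fix' ij); auto.
by apply: hmodP => y; rewrite !(hmodD, hmodZ) !cstR; ring.
Qed.

Lemma hop_gen_near i j p : j = i.+1 :> nat ->
  T i (T j (T i p)) = T j (T i (T j p)).
Proof.
move=> ij; move: p; apply: hop_gen_ext => [||f x].
- exact: Tcomp (hop_gen_linear i) (Tcomp (hop_gen_linear j) (hop_gen_linear i)).
- exact: Tcomp (hop_gen_linear j) (Tcomp (hop_gen_linear i) (hop_gen_linear j)).
apply: (@near_act F r v _ hact hactDl hactDr hactM T TD) => //;
  first exact: hop_gen_act.
rewrite !Tdelta2.
have p1 : pos1 i = pos0 j by apply: val_inj.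
have n0 : srefl j (pos0 i) = pos0 i by rewrite tpermD // -val_eqE /=; lia.
have n1 : srefl i (pos1 j) = pos1 j by rewrite tpermD // -val_eqE /=; lia.
have -> : wmul (srefl i) (wmul (srefl j) (wmul (srefl i) x)) =
          wmul (srefl j) (wmul (srefl i) (wmul (srefl j) x)).
  by rewrite /wmul -!mulgA (near_braid ij).
rewrite !wmul_sreflK !ldesc_srefl.
have -> : ldesc i (wmul (srefl j) (wmul (srefl i) x)) = ldesc j x.
  by rewrite /ldesc !srefl_inv n0 p1 !srefl_pos0 n1 p1.
have -> : ldesc j (wmul (srefl i) (wmul (srefl j) x)) = ldesc i x.
  by rewrite /ldesc !srefl_inv n1 srefl_pos1 -p1 srefl_pos1 n0.
have E : ldesc i (wmul (srefl j) x) = ldesc j (wmul (srefl i) x).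
  by rewrite /ldesc !srefl_inv n0 n1 p1 srefl_pos0 -p1 srefl_pos1.
(* The three descent conditions compare three numbers pairwise; transitivity excludes two of the
   eight cases. *)
have c1 : ldesc i x -> ldesc j x -> ldesc j (wmul (srefl i) x).
  by rewrite -E /ldesc !srefl_inv n0 p1 srefl_pos0; lia.
have c2 : ~~ ldesc i x -> ~~ ldesc j x -> ~~ ldesc j (wmul (srefl i) x).
  by rewrite -E !ldescN !srefl_inv n0 p1 srefl_pos0; lia.
rewrite E; apply: hmodP => y; rewrite !(hmodD, hmodZ) !cstR; move: c1 c2.
case: (ldesc i x); case: (ldesc j x); case: (ldesc j _) => //= c1 c2;
  rewrite ?mulr0n ?mulr1n ?cstR; try ring.
all: by [have := c1 isT isT | have := c2 isT isT].
Qed.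
End HeckeModule.

(** * The sum of all Hecke operators *)

Section Symmetrizer.
Variables (F : fieldType) (r : nat) (q : F).
Hypothesis q0 : q != 0.
Implicit Types (w x y u z : 'S_r) (i j : 'I_r.-1) (f g : laurent F r).
Implicit Types (p : hmod F r).
Local Notation s i := (@lact F r (srefl i)).
Local Notation N i := (@ddiff F r i).
Local Notation U := (demW q).
Local Notation W0 := (w0 r).
Local Notation T := (hop_gen q).
Local Notation v := (q ^+ 2).

Definition hsym p : hmod F r := \sum_w hop T w p.

Lemma hsym_linear : linear hsym.
Proof.
move=> c p p'; rewrite /hsym scaler_sumr -big_split; apply: eq_bigr => w _.
exact: (hop_linear (hop_gen_linear q)).
Qed.

Lemma hop_gen_hsym i p : T i (hsym p) = v *: hsym p.
Proof.
have := @hop_sum_left r F _ T (hop_gen_far q) (hop_gen_near q)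
  (hop_gen_linear q) v (hop_gen_quad q) [set: 'S_r] i p.
have E : \sum_(u in [set: 'S_r]) hop T u p = hsym p.
  by apply: eq_bigl => u; rewrite inE.
by rewrite E; apply=> u _; rewrite inE.
Qed.

Lemma hsym_hop_gen i p : hsym (T i p) = v *: hsym p.
Proof.
exact: (hop_sum_right (hop_gen_far q) (hop_gen_near q) (hop_gen_linear q)
  (hop_gen_quad q)).
Qed.

(** The Bernstein relation moves [T_i] in front of [f], where the symmetrizer turns it into [v].
    What remains is [v s_i f + (v - 1) N_i f], which is [-v U_i f]. *)
Lemma hsym_act i f p : hsym (hact f (T i p)) = - v *: hsym (hact (U i f) p).
Proof.
have -> : hact f (T i p) =
    T i (hact (s i f) p) + hact ((v - 1) *: N i f) p.
  apply: (addIr (hact ((v - 1)%:A * N i (s i f)) p)).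
  rewrite hop_gen_act lact_sreflK ddiff_srefl -!addrA; congr (_ + _).
  by apply: hmodP => x; rewrite !(hmodD, hactE) !cstR; ring.
rewrite (linD hsym_linear) hsym_hop_gen -!(linZ hsym_linear) -(linD
  hsym_linear).
congr hsym; apply: hmodP => x; rewrite !(hmodD, hmodZ, hactE) demWE.
rewrite !cstR.
have : cst r q ^+ 2 * cst r (q ^- 2) = 1 by rewrite -cstX -cstM mulfV ?cst1
  ?expf_neq0.
set a := cst r (q ^- 2); set b := cst r q => E.
transitivity ((b ^+ 2 * s i f + (b ^+ 2 - 1) * N i f) * p x); first by ring.
transitivity ((b ^+ 2 * s i f + (b ^+ 2 - b ^+ 2 * a) * N i f) * p x);
  last by ring.
by rewrite E.
Qed.

(** Each letter uses [hsym_act] at [s_i x], where [i] is a descent and [hop_gen_delta] leaves only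
    [-q *: hdelta x]. Against the factor [-v] this gives one [q] per letter. *)
Lemma hsym_hact_hop x f :
  hsym (hact f (hdelta F 1%g)) = q ^+ len x *: hsym (hact (hop U x f) (hdelta
    F x)).
Proof.
move: x; apply: perm_lind => [|i x nd ->].
  by rewrite len1 scale1r hop1.
rewrite len_srefl // exprSr -scalerA; congr (_ *: _).
rewrite (hop_srefl (demW_far q) (demW_near q)) //.
have := hsym_act i (hop U x f) (hdelta F (wmul (srefl i) x)).
rewrite hop_gen_delta wmul_sreflK ldesc_srefl nd mulr0n scale0r addr0.
have -> : hact (hop U x f) (- q *: hdelta F x) = - q *: hact (hop U x f)
  (hdelta F x).
  by apply: hmodP => y; rewrite !(hmodZ, hactE) !cstR; ring.
rewrite (linZ hsym_linear) !scaleNr => /oppr_inj; rewrite expr2 -scalerA.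
exact: (scalerI q0).
Qed.

(** Triangularity: [T_i] raises the length of the support by at most one. At [s_i w] the old
    coefficient is zero, so only the term [-q *: s_i] of [hop_gen] contributes there. *)
Lemma hop_delta w f :
  (forall x, (len w < len x)%N -> hop T w (hact f (hdelta F 1%g)) x = 0) /\
  hop T w (hact f (hdelta F 1%g)) w = (- q) ^+ len w *: lact w f.
Proof.
move: w; apply: perm_lind => [|i w nd [IH0 IH1]].
  rewrite hop1 len1 scale1r; split=> [x|];
    last by rewrite hactE hdeltaE eqxx mulr1 lact_id.
  rewrite hactE hdeltaE; case: eqP => [->|_]; first by rewrite len1.
  by rewrite mulr0.
rewrite len_srefl // (hop_srefl (hop_gen_far q) (hop_gen_near q)) //.
have D0 : N i (0 : laurent F r) = 0 by exact: (lin0 (ddiff_linear i)).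
have S0 : s i (0 : laurent F r) = 0 by exact: (lin0 (lact_linear _)).
split=> [x lx|].
  rewrite hop_genE (IH0 x) 1?ltnW // IH0 ?S0 ?D0 ?mulr0 ?addr0 ?scaler0 ?addr0
    //.
  have [/len_sreflD E|/len_srefl->] := boolP (ldesc i x); last by lia.
  by rewrite E ltnS in lx.
rewrite hop_genE (IH0 (wmul (srefl i) w)) ?len_srefl //.
rewrite S0 D0 mulr0 addr0 scaler0 addr0 wmul_sreflK IH1 lactZ scalerA -exprS.
by rewrite lactM.
Qed.

Lemma hsym_w0 f :
  hsym (hact f (hdelta F 1%g)) W0 = (- q) ^+ len W0 *: lact W0 f.
Proof.
rewrite /hsym hmod_sum (bigD1 W0) //= (hop_delta W0 f).2 big1 ?addr0 // => w nw.
apply: (hop_delta w f).1; rewrite ltnNge; apply: contra nw => /len_w0_uniq->.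
exact: eqxx.
Qed.

(** At [w_0 z], where [rev j] is a descent, the equation [T S = v S] can be solved for the
    coefficient at [w_0 s_j z]. As [w_0] sends the root of [rev j] to [- alpha j], the divided
    difference changes sign and [q U_j] appears. *)
Lemma hsym_step p j z : ~~ ldesc j z ->
  lact W0 (hsym p (wmul W0 (wmul (srefl j) z))) =
  q *: U j (lact W0 (hsym p (wmul W0 z))).
Proof.
move=> nd; have d : ldesc (rev_ord j) (wmul W0 z) by rewrite ldesc_w0.
have := congr1 (fun p' : hmod F r => p' (wmul W0 z)) (hop_gen_hsym (rev_ord j)
  p).
rewrite /= hop_genE hmodZ d mul0r add0r.
rewrite wmulA -w0_srefl -wmulA; set P := hsym p _; set P' := hsym p _.
rewrite -[P']/P' => E.
have E2 : P = - q *: s (rev_ord j) P' + (q - q^-1) *: s (rev_ord j) (N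
  (rev_ord j) P').
  apply: (can_inj (@lact_sreflK F r (rev_ord j))).
  rewrite (linD (lact_linear _)) !lactZ !lact_sreflK.
  have q0N : - q != 0 by rewrite oppr_eq0.
  apply: (scalerI q0N).
  have -> : - q *: s (rev_ord j) P = v *: P' - (v - 1) *: N (rev_ord j) P'.
    by rewrite -E addrK.
  rewrite scalerDr !scalerA -scaleNr.
  congr (_ *: _ + _ *: _); first by rewrite mulrN mulNr opprK expr2.
  by rewrite mulrBr !mulNr mulfV // expr2 opprB opprK addrC.
rewrite E2 (linD (lact_linear _)) !lactZ.
rewrite (@lact_ddiff_conjN _ _ _ _ j); last first.
- by rewrite w0_pos1 rev_ordK.
- by rewrite w0_pos0 rev_ordK.
have -> : lact W0 (s (rev_ord j) P') = s j (lact W0 P').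
  by rewrite -!lactM w0_srefl rev_ordK.
rewrite demWE scalerDr !scalerA scalerN -scaleNr; congr (_ + _).
  by rewrite scalerN scaleNr.
congr (_ *: _); rewrite mulrBr mulr1 opprB; congr (_ - _).
by rewrite expr2 invfM mulrA mulfV // mul1r.
Qed.

Lemma hsym_w0_mul f z :
  hsym (hact f (hdelta F 1%g)) (wmul W0 z) =
  (- q) ^+ len W0 * q ^+ len z *: lact W0 (hop U z f).
Proof.
apply: (can_inj (@lact_w0K F r)); rewrite lactZ lact_w0K.
move: z; apply: perm_lind => [|i z nd IH].
  by rewrite wmul1r hsym_w0 lactZ lact_w0K hop1 len1 mulr1.
rewrite hsym_step // IH (hop_srefl (demW_far q) (demW_near q)) // len_srefl //.
rewrite (linZ (demW_linear q i)) scalerA; congr (_ *: _).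
by rewrite exprS mulrCA.
Qed.

Lemma hsym_hop_coef x f z :
  hsym (hact (hop U x f) (hdelta F x)) (wmul W0 z) =
  q ^- len x * ((- q) ^+ len W0 * q ^+ len z) *: lact W0 (hop U z f).
Proof.
have := hsym_w0_mul f z; rewrite (hsym_hact_hop x) hmodZ => E.
by rewrite -[RHS]scalerA -E scalerA mulVf ?scale1r // expf_neq0.
Qed.
End Symmetrizer.

(** * The metaplectic operators *)

Section Metaplectic.
Variables (F : fieldType) (r n : nat) (q : F) (g : int -> F).
Hypothesis n0 : (0 < n)%N.
Hypothesis q0 : q != 0.
Hypothesis g_dvd : forall j, (n%:Z %| j)%Z -> g j = -1.
Hypothesis g_per : forall j, g (j + n%:Z) = g j.
Hypothesis g_ndvd : forall j, ~~ (n%:Z %| j)%Z ->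
  g j * g (n%:Z - j) = (q ^+ 2)^-1.
Implicit Types (w x y u z : 'S_r) (i j : 'I_r.-1) (f m : laurent F r).
Implicit Types (a b eta : weight r).
Local Notation v := (q ^+ 2).
Local Notation s i := (@lact F r (srefl i)).
Local Notation N i := (@ddiff F r i).
Local Notation sp := (@subst_pow F r n).

Lemma g_perM (k t : int) : g (k + n%:Z * t) = g k.
Proof.
have P (p : nat) k' : g (k' + n%:Z * p%:Z) = g k'.
  elim: p => [|p IH]; first by rewrite mulr0 addr0.
  by rewrite -[in RHS]IH -[RHS]g_per; congr g; rewrite -addrA; congr (_ + _);
    rewrite -addn1 PoszD mulrDr mulr1.
case: t => p; first exact: P.
by rewrite -[LHS](P p.+1); congr g; rewrite NegzE mulrN subrK.
Qed.

Lemma g_eq (k l : int) : (n%:Z %| k - l)%Z -> g k = g l.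
Proof. by case/dvdzP => t E; rewrite -(g_perM l t); congr g; rewrite mulrC -E;
  lia. Qed.

Lemma g0 : g 0 = -1. Proof. by apply: g_dvd; rewrite dvdz0. Qed.

Lemma g_opp (k : int) : ~~ (n%:Z %| k)%Z -> g k * g (- k) = v^-1.
Proof. by move=> /g_ndvd <-; rewrite [n%:Z - k]addrC g_per. Qed.

Definition wres a : weight r := [ffun k => (a k %% n%:Z)%Z].
(** The monomials with exponents in the window form a basis of the Laurent polynomials over those in
    [y^n]. *)
Definition window a := [forall k, 0 <= a k < n%:Z].

Lemma windowP a : reflect (forall k, 0 <= a k < n%:Z) (window a).
Proof. exact: forallP. Qed.

Lemma wres_window a : window (wres a).
Proof.
by apply/windowP => k; rewrite ffunE modz_ge0 ?ltz_pmod //; lia.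
Qed.

Lemma weight_div a : a = wfloor n a *+ n + wres a.
Proof.
by apply/ffunP => k; rewrite !ffunE ffunMnE ffunE {1}(divz_eq (a k) n%:Z)
  -mulr_natr natz.
Qed.

Lemma window_act w a : window a -> window (wact w a).
Proof. by move/windowP => H; apply/windowP => k; rewrite ffunE. Qed.

Lemma wfloor_window a eta : window eta -> wfloor n (a *+ n + eta) = a.
Proof.
move/windowP => H; apply/ffunP => k; rewrite !ffunE ffunMnE -mulr_natr natz.
by rewrite divzMDl ?divz_small ?addr0 //; have := H k; lia.
Qed.

Lemma wres_winE a eta : window eta -> wres (a *+ n + eta) = eta.
Proof.
move/windowP => H; apply/ffunP => k; rewrite !ffunE ffunMnE -mulr_natr natz.
by rewrite modzMDl modz_small //; have := H k; lia.
Qed.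

(** The value of [kop i] at a window monomial. [metaT] has a diagonal term at [y^(-eta)] exactly
    when [eta_i > eta_{i+1}]; passing to the inverse moves it to the complementary case. *)
Definition kgen i eta : laurent F r :=
  v * g (eta (pos0 i) - eta (pos1 i)) *: ypow (wact (srefl i) eta)
  + ((v - 1) *+ (eta (pos0 i) <= eta (pos1 i))%R) *: ypow eta.

(* The operator [iota \o (- q *: (metaT i)^-1) \o iota], in a form where its
   Bernstein relation with [y^n] is visible. *)
Definition kop i : laurent F r -> laurent F r := lext (fun a =>
  sp (ypow (wact (srefl i) (wfloor n a))) * kgen i (wres a)
  + (v - 1) *: (sp (N i (ypow (wfloor n a))) * ypow (wres a))).

Lemma kop_linear i : linear (kop i).
Proof. by move=> c f m; rewrite /kop linearP. Qed.

Lemma kop_window i f eta : window eta -> kop i (sp f * ypow eta) =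
  sp (s i f) * kgen i eta + (v - 1) *: (sp (N i f) * ypow eta).
Proof.
move=> H; move: f; apply: linear_ypow_eq => [c f m|c f m|a].
- by rewrite sp_linear mulrDl -scalerAl kop_linear.
- rewrite lact_linear ddiff_linear !sp_linear !cstR; ring.
by rewrite spU -ypowD /kop lext_ypow wfloor_window // wres_winE // lactU.
Qed.

Lemma ypow_div a : ypow a = sp (ypow (wfloor n a)) * ypow (wres a).
Proof. by rewrite spU -ypowD -weight_div. Qed.

Lemma sp_alg c : sp c%:A = c%:A.
Proof. by rewrite (linZ (sp_linear n)) sp1. Qed.

Lemma kop_act i f m : kop i (sp f * m) =
  sp (s i f) * kop i m + sp ((v - 1)%:A * N i f) * m.
Proof.
move: m; apply: linear_ypow_eq => [c m p|c m p|a].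
- by rewrite mulrDr -scalerAr kop_linear.
- rewrite kop_linear !cstR; ring.
rewrite ypow_div mulrA -spM !kop_window ?wres_window //.
rewrite ddiffM lactMul (linD (sp_linear n)) !spM sp_alg !cstR; ring.
Qed.

Lemma kop_winE i eta : window eta -> kop i (ypow eta) = kgen i eta.
Proof.
move=> H; have := @kop_window i 1 eta H.
by rewrite sp1 !mul1r lact1 sp1 mul1r ddiff_sym ?lact1 // (lin0 (sp_linear n))
  mul0r scaler0 addr0.
Qed.

Lemma wact_srefl_pos0 i a : wact (srefl i) a (pos0 i) = a (pos1 i).
Proof. by rewrite ffunE sreflV srefl_pos0. Qed.

Lemma wact_srefl_pos1 i a : wact (srefl i) a (pos1 i) = a (pos0 i).
Proof. by rewrite ffunE sreflV srefl_pos1. Qed.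

Lemma window_ndvd eta (k l : 'I_r) : window eta -> eta k != eta l ->
  ~~ (n%:Z %| eta k - eta l)%Z.
Proof.
move/windowP => H; apply: contra => /dvdzP[t E].
have := H k; have := H l => Hl Hk; suff t0 : t = 0 by apply/eqP; lia.
by nia.
Qed.

Lemma window_gg i eta : window eta -> eta (pos0 i) != eta (pos1 i) ->
  v * g (eta (pos0 i) - eta (pos1 i)) * (v * g (eta (pos1 i) - eta (pos0 i)))
    = v.
Proof.
move=> H ne; have := g_opp (window_ndvd H ne); rewrite opprB => E.
by rewrite mulrACA E -mulrA mulfV ?mulr1 // expf_neq0.
Qed.

(** By [quad_act] only window monomials matter. For distinct entries the product of the two
    off-diagonal coefficients is [v] by [window_gg]; for equal ones [kop i] acts by
    [-v + (v - 1) = -1]. *)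
Lemma kop_quad i m : kop i (kop i m) = (v - 1) *: kop i m + v *: m.
Proof.
move: m; apply: linear_ypow_eq => [c m p|c m p|a].
- by rewrite !kop_linear.
- by rewrite kop_linear !cstR; ring.
rewrite ypow_div; set eta := wres a; have H : window eta by exact: wres_window.
have E : quad_at v (fun f m => sp f * m) kop i (ypow eta).
  have KZ c m : kop i (c *: m) = c *: kop i m by exact: (linZ (kop_linear i)).
  have KD' m p : kop i (m + p) = kop i m + kop i p by exact: (linD (kop_linear
    i)).
  rewrite /quad_at !sp_alg !kop_winE // /kgen KD' !KZ !kop_winE ?window_act //.
  rewrite /kgen -!wactM /wmul sreflK wact1 wact_srefl_pos0 wact_srefl_pos1.
  have [Eq|ne] := eqVneq (eta (pos0 i)) (eta (pos1 i)).
    have -> : wact (srefl i) eta = eta by rewrite wact_srefl Eq subrr mulr0z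
      subr0.
    by rewrite Eq subrr g0 lexx mulr1n !cstR; ring.
  have := window_gg H ne.
  move: (v * g (_ - _)) (v * g (_ - _)) => A B /(congr1 (cst r)) AB.
  rewrite cstM cstX in AB; rewrite !cstR -!cstX.
  case: (ltgtP (eta (pos0 i)) _) ne => //= _ _;
  rewrite ?mulr0n ?mulr1n !cstR; move: AB;
  set al := cst r A; set be := cst r B; set Q := cst r q => AB.
  - transitivity (be * al * ypow eta + (Q ^+ 2 - 1) * (be * ypow (wact (srefl
      i) eta) + (Q ^+ 2 - 1) * ypow eta)); [ring|by rewrite AB; ring].
  - transitivity (be * al * ypow eta + (Q ^+ 2 - 1) * (be * ypow (wact (srefl
      i) eta))); [ring|by rewrite AB; ring].
have actDl f e m : sp (f + e) * m = sp f * m + sp e * m.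
  by rewrite (linD (sp_linear n)) mulrDl.
have actA f e m : sp (f * e) * m = sp f * (sp e * m) by rewrite spM mulrA.
have := @quad_act F r v _ (fun f m => sp f * m) actDl (fun f => mulrDr (sp f))
  actA kop (fun i => linD (kop_linear i)) kop_act i (ypow (wfloor n a)) (ypow
    eta) E.
by rewrite /quad_at !sp_alg !mulr_algl.
Qed.

Lemma spB f m : sp (f - m) = sp f - sp m.
Proof. exact: (linB (sp_linear n)). Qed.

Lemma iotaB f m : iota_y (f - m) = iota_y f - iota_y m.
Proof. exact: (linB (@iota_linear F r)). Qed.

Lemma iotaD f m : iota_y (f + m) = iota_y f + iota_y m.
Proof. exact: (linD (@iota_linear F r)). Qed.

Lemma iotaZ c f : iota_y (c *: f) = c *: iota_y f.
Proof. exact: (linZ (@iota_linear F r)). Qed.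

Lemma kop_iota_linear i : linear (fun f => iota_y (kop i (iota_y f)) : laurent
  F r).
Proof. by move=> c f m; rewrite iota_linear kop_linear iota_linear. Qed.

Lemma metaT_linear i : linear (metaT n q g i : laurent F r -> laurent F r).
Proof. by move=> c f m; rewrite /metaT linearP. Qed.

(** In the form [-q^-1 (K - (v - 1))] the inverse [-q^-1 K] is visible from the quadratic relation
    of [K]. The proof splits [-a] into [n] times a weight and a window part. *)
Lemma metaTE i f : metaT n q g i f =
  - q^-1 *: (iota_y (kop i (iota_y f)) - (v - 1) *: f).
Proof.
move: f; apply: linear_ypow_eq => [c f m|c f m|a].
- exact: metaT_linear.
- by rewrite kop_iota_linear !cstR; ring.
rewrite /metaT lext_ypow iotaU [in kop _ _]ypow_div.
move: (weight_div (- a)) (wres_window (- a)).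
move: (wfloor n (- a)) (wres (- a)) => fl eta Ea H; rewrite kop_window //.
set A := a (pos0 i) - a (pos1 i); pose b := eta (pos0 i) - eta (pos1 i).
pose k := fl (pos0 i) - fl (pos1 i).
have EA : - A = k * n%:Z + b.
  have E t : - a t = fl t * n%:Z + eta t.
    have := congr1 (fun c : weight r => c t) Ea.
    by rewrite !ffunE ffunMnE -mulr_natr natz.
  by rewrite /A opprB addrC; have := E (pos0 i); have := E (pos1 i);
    rewrite /k /b; lia.
have Eg : g (- A) = g b by apply: g_eq; rewrite EA addrK dvdz_mull.
have Hb : - n%:Z < b < n%:Z.
  by move/windowP: H => H; have := H (pos0 i); have := H (pos1 i); rewrite /b;
    lia.
(* As [-A = k n + b] with [|b| < n], the residue of [A] is [-b] or [n - b]; [e] is the resulting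
   quotient of [r_n(A) - A] by [n]. *)
pose e : int := if b <= 0 then k else k + 1.
have Ee : ((A %% n%:Z)%Z - A) = n%:Z * e.
  have EA2 : A = (- e) * n%:Z + (if b <= 0 then - b else n%:Z - b).
    by rewrite /e; case: ifP => _; nia.
  rewrite [in LHS]EA2 modzMDl modz_small; last by case: ifP => hb; lia.
  by case: ifP => _; ring.
have X0 : alpha i *+ n != 0.
  apply/eqP => /(congr1 (fun c : weight r => c (pos0 i))).
  by rewrite ffunMnE alpha_pos0 ffunE natz; lia.
have [D ED] := metaT_dvd F n (alpha i) A.
have := ldivK (ex_intro _ D ED); move: {D ED}(ldiv _ _) => D.
pose Xk : laurent F r := ypow (alpha i *~ (n%:Z * k)).
set X : laurent F r := ypow (alpha i *+ n) => ED.
have EXe : ypow (alpha i *~ ((A %% n%:Z)%Z - A)) = if b <= 0 then Xk else X *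
  Xk :> laurent F r.
  rewrite Ee /e /Xk /X; case: ifP => // _.
  by rewrite -ypowD pmulrn -mulrzDr mulrDr mulr1 addrC.
rewrite EXe in ED.
have Es : wact (srefl i) fl = fl - alpha i *~ k by rewrite wact_srefl.
have Ea2 : a = - (fl *+ n) - eta by rewrite -opprD -Ea opprK.
have Efs : - (wact (srefl i) fl *+ n) - eta = alpha i *~ (n%:Z * k) + a.
  rewrite Ea2 addrA; congr (_ - _); rewrite Es mulrnBl opprB; congr (_ - _).
  by rewrite pmulrn -mulrzA mulrC.
pose M := iota_y (sp (N i (ypow fl)) * ypow eta) : laurent F r.
have EM : M * (1 - X) = - (X * (ypow a * (1 - Xk))).
  have := congr1 (fun f => iota_y (sp f) * ypow (- eta)) (ddiffK i (ypow fl)).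
  rewrite /= lactU !(spM, spB, sp1, spU) !(iotaM, iotaB, iota1, iotaU).
  rewrite [in RHS]mulrBl -!ypowD Efs -Ea2 ypowD -/Xk /M iotaM iotaU.
  move: (iota_y (sp _)) (ypow (- eta)) => Nf ye E.
  have XX : X * ypow (- (alpha i *+ n)) = 1 by rewrite -ypowD subrr ypow0.
  transitivity (- (X * (Nf * (1 - ypow (- (alpha i *+ n))) * ye))).
    transitivity (Nf * ye * (X * ypow (- (alpha i *+ n)) - X));
      [by rewrite XX | ring].
  by rewrite E; ring.
(* Over the denominator [1 - X] the poles of the fraction of [metaT] and of the divided difference
   [M] cancel in the sum; [y^a] remains, minus [Xk * y^a] if [b <= 0]. *)
have key : D * ypow a = ypow a - (b <= 0)%R%:R * (Xk * ypow a) - M.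
  apply: (mul_1subU_inj X0); rewrite -/X [RHS]mulrBl EM.
  transitivity (ypow a * (D * (1 - X))); first by ring.
  by rewrite ED; case: (b <= 0) => /=; ring.
have bE : (eta (pos0 i) <= eta (pos1 i)) = (b <= 0) by rewrite /b subr_le0.
rewrite key Eg /kgen bE lactU spU !iotaD mulrDr -!scalerAr -!ypowD.
rewrite -wactMn -wactD -Ea iotaD !iotaZ !iotaU wactN opprK -/b -/M wactMn
  opprD Efs ypowD -/Xk.
have QQ : cst r q^-1 * cst r q = 1 by rewrite -cstM mulVf ?cst1.
have -> : ((v - 1) *+ (b <= 0)%R) *: (Xk * ypow a) =
    (v - 1) *: ((b <= 0)%R%:R * (Xk * ypow a)) :> laurent F r.
  by case: (b <= 0); rewrite ?mul0r ?scaler0 ?mulr0n ?scale0r ?mul1r.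
rewrite !cstR; move: QQ; set Q := cst r q; set Qi := cst r q^-1 => QQ.
set G := cst r (g b); set Y := ypow _; set P := _%:R * _.
transitivity (- (Qi * Q * Q * G * Y) + (Qi * Q * Q - Qi) * (ypow a - P - M)).
  by rewrite QQ; ring.
ring.
Qed.

(** [opinv] picks some preimage, so both halves are needed: [Tr] shows that one exists, and the left
    inverse identifies the one picked. *)
Lemma metaT_inv i f : opinv (metaT n q g i) f = - q^-1 *: iota_y (kop i
  (iota_y f)).
Proof.
have QQ : cst r q^-1 * cst r q = 1 by rewrite -cstM mulVf ?cst1.
have Tr : metaT n q g i (- q^-1 *: iota_y (kop i (iota_y f))) = f.
  rewrite metaTE !iotaZ iotaK (linZ (kop_linear i)) kop_quad iotaZ iotaD
    !iotaZ iotaK.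
  rewrite !cstR; transitivity (cst r q^-1 * cst r q * (cst r q^-1 * cst r q) *
    f).
    by ring.
  by rewrite QQ !mul1r.
have := epsilon_spec (inhabits 0) (fun h => metaT n q g i h = f) (ex_intro _ _
  Tr).
rewrite -/(opinv _ _); move: (opinv _ _) => h <-.
rewrite metaTE iotaZ iotaB !iotaZ iotaK (linZ (kop_linear i)) (linB
  (kop_linear i)).
rewrite (linZ (kop_linear i)) kop_quad iotaZ iotaB iotaD !iotaZ iotaK.
rewrite !cstR; transitivity (cst r q^-1 * cst r q * (cst r q^-1 * cst r q) * h).
  by rewrite QQ !mul1r.
by ring.
Qed.

Lemma iota_metaDemW i f :
  iota_y (metaDemW n q g i (iota_y f)) = ypow (- rho r) * kop i (ypow (rho r)
    * f).
Proof.
rewrite /metaDemW metaT_inv [iota_y (ypow (- rho r) * _)]iotaM iotaU opprK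
  iotaK.
by rewrite iotaZ iotaM iotaU iotaZ iotaK -scalerAr scalerA mulrNN mulfV //
  scale1r.
Qed.

(** The factors [y^rho] and [y^(-rho)] between consecutive letters cancel. *)
Lemma iota_opw_metaDemW w f :
  iota_y (opw (metaDemW n q g) w (iota_y f)) =
  ypow (- rho r) * hop kop w (ypow (rho r) * f).
Proof.
rewrite /opw /hop; elim: (redword w) => [|i t IH] /=.
  by rewrite iotaK mulrA -ypowD addNr ypow0 mul1r.
rewrite -[foldr (metaDemW n q g) _ t]iotaK IH iota_metaDemW mulrA -ypowD.
by rewrite subrr ypow0 mul1r.
Qed.

(** * From the regular module to the metaplectic operators *)

Section Transfer.
Variable c : weight r.
Hypothesis cdec : decreasing c.
Hypothesis cn : forall k, 1 <= c k <= n%:Z.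

Definition cwin : weight r := [ffun k => n%:Z - c k].

Lemma cwin_window : window cwin.
Proof. by apply/windowP => k; rewrite ffunE; move: (cn k); clear; lia. Qed.

Definition transfer (p : hmod F r) : laurent F r :=
  \sum_x hfac q g c x *: (sp (p x) * ypow (wact x cwin)).

Lemma transfer_linear : linear transfer.
Proof.
move=> a p p'; rewrite /transfer scaler_sumr -big_split; apply: eq_bigr => x _.
by rewrite hmodD hmodZ sp_linear !cstR /=; ring.
Qed.

Lemma transfer_act f x : transfer (hact f (hdelta F x)) =
  hfac q g c x *: (sp f * ypow (wact x cwin)).
Proof.
rewrite /transfer (bigD1 x) //= hactE hdeltaE eqxx mulr1 big1 ?addr0 // => y yx.
by rewrite hactE hdeltaE (negPf yx) mulr0 (lin0 (sp_linear n)) mul0r scaler0.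
Qed.

(** At an ascent the recursion of [hfac] turns [v g] into [-q] times a ratio of scalars; at a
    descent the same follows from [g k * g (- k) = v^-1]. *)
Lemma hfac_kgen i x : hfac q g c x *: kgen i (wact x cwin) =
  - q * hfac q g c (wmul (srefl i) x) *: ypow (wact (wmul (srefl i) x) cwin)
  + ((v - 1) *+ ~~ ldesc i x * hfac q g c x) *: ypow (wact x cwin).
Proof.
rewrite /kgen scalerDr !scalerA -!wactM !ffunE.
set k := x^-1%g (pos0 i); set l := x^-1%g (pos1 i).
have -> : n%:Z - c k - (n%:Z - c l) = - (c k - c l) by lia.
have -> : (n%:Z - c k <= n%:Z - c l) = (c l <= c k) by lia.
have [d|nd] := boolP (ldesc i x); last first.
  have le : c l <= c k by apply: cdec; rewrite ltnW // -ldescN.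
  rewrite hfac_srefl // le !mulr1n; congr (_ *: _ + _ *: _); ring.
have := hfac_srefl q g c (i := i) (w := wmul (srefl i) x).
rewrite ldesc_srefl d wmul_sreflK => /(_ isT).
rewrite !srefl_inv srefl_pos0 srefl_pos1 -/k -/l => ->.
have le : c k <= c l by apply: cdec; apply: ltnW.
rewrite mulr0n mul0r scale0r addr0.
set h := hfac _ _ _ _.
(* At equal entries [s_i] fixes the monomial, and the two coefficients of [kgen] add up to [-1]. *)
have [E|ne] := eqVneq (c k) (c l).
  rewrite E subrr oppr0 g0 lexx mulr1n wactM.
  have -> : wact (srefl i) (wact x cwin) = wact x cwin.
    by rewrite wact_srefl !ffunE -/k -/l E subrr mulr0z subr0.
  by rewrite -scalerDl; congr (_ *: _); ring.
have -> : (c l <= c k) = false by apply/negP => ?; move/negP: ne; apply;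
  rewrite eq_le le.
rewrite mulr0n mulr0 scale0r addr0; congr (_ *: _).
have : v * g (- (c k - c l)) * (v * g (- (c l - c k))) = v.
  have := window_gg (i := i) (window_act x cwin_window).
  rewrite !ffunE -/k -/l => H; rewrite -[RHS]H;
    last by apply: contra ne => /eqP ?; apply/eqP; lia.
  by congr (_ * g _ * (_ * g _)); lia.
move=> E; have v0 : v != 0 by rewrite expf_neq0.
have {}E : v * g (- (c k - c l)) * g (- (c l - c k)) = 1.
  by apply: (mulfI v0); rewrite mulr1 -[RHS]E; ring.
transitivity (- q * h * (v * g (- (c k - c l)) * g (- (c l - c k))));
  first by ring.
by rewrite E mulr1.
Qed.

Lemma kop_transfer i p : kop i (transfer p) = transfer (hop_gen q i p).
Proof.
have lA : linear (fun p => kop i (transfer p)).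
  by move=> a p1 p2; rewrite transfer_linear kop_linear.
have lB : linear (fun p => transfer (hop_gen q i p)).
  by move=> a p1 p2; rewrite hop_gen_linear transfer_linear.
rewrite [p]hmodE (lin_sum lA) (lin_sum lB); apply: eq_bigr => x _.
move: (p x) => f; rewrite transfer_act (linZ (kop_linear i)).
rewrite kop_window ?window_act ?cwin_window //.
rewrite hop_gen_act hop_gen_delta hactDr (linD transfer_linear) (linD
  transfer_linear).
have hZ (t : F) e y : transfer (hact e (t *: hdelta F y)) =
    t * hfac q g c y *: (sp e * ypow (wact y cwin)).
  rewrite -scalerA -transfer_act -(linZ transfer_linear); congr transfer.
  by apply: hmodP => z; rewrite !(hmodZ, hactE) !cstR; ring.
rewrite !hZ transfer_act spM sp_alg scalerDr scalerAr hfac_kgen.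
rewrite !cstR; ring.
Qed.

Lemma hop_transfer w p : hop kop w (transfer p) = transfer (hop (hop_gen q) w
  p).
Proof. by rewrite /hop; elim: (redword w) => //= i t ->;
  rewrite kop_transfer. Qed.

Lemma sum_hop_transfer p : \sum_w hop kop w (transfer p) = transfer (hsym q p).
Proof. by rewrite (lin_sum transfer_linear); apply: eq_bigr => w _;
  apply: hop_transfer. Qed.
End Transfer.

End Metaplectic.

(** * Residues modulo n and the theorem *)

Section Residues.
Variables (r n : nat).
Hypothesis n0 : (0 < n)%N.
Implicit Types (w x y u z : 'S_r) (a b c : weight r).

(** The representative of [-a] modulo [n] with entries in [1..n], the range prescribed for [c]. *)
Definition cres a : weight r := [ffun k => n%:Z - (a k %% n%:Z)%Z].

Definition in_range c := forall k, 1 <= c k <= n%:Z.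

Lemma cres_range a : in_range (cres a).
Proof.
move=> k; rewrite ffunE; have nz : n%:Z != 0 by lia.
have m1 : (a k %% n%:Z)%Z < n%:Z by apply: ltz_pmod; lia.
by have := modz_ge0 (a k) nz; lia.
Qed.

Lemma wact_range w c : in_range (wact w c) <-> in_range c.
Proof.
split=> H k; last by rewrite ffunE.
by have := H (w k); rewrite wactE.
Qed.

Lemma wact_cres w a : wact w (cres a) = cres (wact w a).
Proof. by apply/ffunP => k; rewrite !ffunE. Qed.

Lemma oppz_mod (k l : int) : 1 <= l <= n%:Z ->
  (- k == l %[mod n%:Z])%Z -> l = n%:Z - (k %% n%:Z)%Z.
Proof.
rewrite eqz_mod_dvd => Hl /dvdzP[t Et]; have nz : n%:Z != 0 by lia.
have m0 := modz_ge0 k nz.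
have m1 : (k %% n%:Z)%Z < n%:Z by apply: ltz_pmod; lia.
move: (divz_eq k n%:Z) m0 m1; move: (k %/ n%:Z)%Z (k %% n%:Z)%Z => d m Ek m0 m1.
have E5 : l + m = - (d + t) * n%:Z.
  have -> : l = - k - t * n%:Z by rewrite -Et; ring.
  by rewrite Ek; ring.
(* [l + m] is a multiple of [n] between [1] and [2n - 1]. *)
suff E6 : - (d + t) = 1 by rewrite E6 in E5; lia.
by move: (- (d + t)) E5 => K E5; nia.
Qed.

Lemma wcongr_cres a c : in_range c -> wcongr n (- a) c = (c == cres a).
Proof.
move=> H; apply/forallP/eqP => [E|-> k]; last first.
  rewrite !ffunE eqz_mod_dvd; apply/dvdzP.
  exists (- (a k %/ n%:Z)%Z - 1); rewrite {1}(divz_eq (a k) n%:Z); ring.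
apply/ffunP => k; rewrite [RHS]ffunE; apply: oppz_mod; first exact: H.
by have := E k; rewrite ffunE.
Qed.

Lemma wcongr_cres_eq a b : wcongr n a b = (cres a == cres b).
Proof.
apply/forallP/eqP => [E|/ffunP E k].
  by apply/ffunP => k; rewrite !ffunE (eqP (E k)).
by have := E k; rewrite !ffunE => /addrI/oppr_inj/eqP.
Qed.

Lemma wact_cwin w c : wact w (cwin n c) = cwin n (wact w c).
Proof. by apply/ffunP => k; rewrite !ffunE. Qed.

Lemma cwin_cres a : cwin n (cres a) = wres n a.
Proof. by apply/ffunP => k; rewrite !ffunE opprB addrC subrK. Qed.

Lemma cwin_inj : injective (@cwin r n).
Proof. by move=> a b /ffunP E; apply/ffunP => k; have := E k;
  rewrite !ffunE => /addrI/oppr_inj. Qed.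

Lemma resid_window (theta : {ffun 'I_r -> 'I_n}) : window n (resid theta).
Proof. by apply/windowP => k; rewrite ffunE /= ltz_nat ltn_ord. Qed.

Lemma wres_window_id a : window n a -> wres n a = a.
Proof.
move=> H; have := wres_winE 0 H.
by rewrite mul0rn add0r.
Qed.

Lemma wdataE (theta : {ffun 'I_r -> 'I_n}) (mu c : weight r) (w w' : 'S_r) :
  wdata theta mu c w w' <->
  [/\ decreasing c /\ in_range c, wact w' c = cres mu,
      wact w c = cres (wact (w0 r) (resid theta)), blockinc c w'
    & blockinc c (wmul (w0 r) w)].
Proof.
split=> [[[cd cr]]|[[cd cr] /eqP E1 /eqP E2 b1 b2]].
  rewrite !wcongr_cres; try exact/wact_range.
  by move=> /eqP E1 /eqP E2 /(minrepP cd) b1 /(minrepP cd) b2; split.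
split; rewrite ?wcongr_cres //; try exact/wact_range.
- exact/minrepP.
exact/minrepP.
Qed.

(** [c] is the sorted rearrangement of [cres mu], and [w'] and [w_0 w] are minimal representatives
    of cosets determined by [mu] and [theta]. *)
Lemma wdata_unique (theta : {ffun 'I_r -> 'I_n}) mu c1 w1 w1' c2 w2 w2' :
  wdata theta mu c1 w1 w1' -> wdata theta mu c2 w2 w2' ->
  (c1, w1, w1') = (c2, w2, w2').
Proof.
move=> /wdataE[[cd1 cr1] E1 E2 b1 b2] /wdataE[[cd2 cr2] E1' E2' b1' b2'].
have Ec : c2 = c1.
  apply: (dec_orbit cd1 (x := wmul w2'^-1%g w1') cd2).
  by rewrite wactM E1 -E1' -wactM wmulVl wact1.
rewrite {c2}Ec in cd2 cr2 E1' E2' b1' b2' *.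
have uniq y y' : blockinc c1 y -> blockinc c1 y' -> wact y c1 = wact y' c1 ->
  y = y'.
  move=> by1 by2 E; have Su : wmul y^-1%g y' \in wstab c1.
    by rewrite inE wactM -E -wactM wmulVl wact1.
  have Ey : wmul y (wmul y^-1%g y') = y' by rewrite wmulA wmulV wmul1l.
  have := minrep_uniq cd1 by1 Su; rewrite Ey => /(_ by2) E3.
  by rewrite -Ey E3 wmul1r.
have -> : w1' = w2' by apply: uniq; rewrite ?E1.
suff -> : w1 = w2 by [].
apply: (@wmul_inj _ (w0 r)); apply: uniq => //.
by rewrite !wactM E2 E2'.
Qed.

(** This half of the data involves [mu] alone, so it is available even if [mu] is not a permutation
    of [theta]. *)
Lemma wdata_half mu : exists c w', [/\ decreasing c, in_range c,
  wact w' c = cres mu & blockinc c w'].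
Proof.
have [x [c [cd E]]] := sort_ex (cres mu).
have [u Su mu_] := minrep_ex c x.
exists c, (wmul x u); split=> //; last exact/minrepP.
  by apply/(wact_range x); rewrite -E; apply: cres_range.
by move: Su; rewrite inE wactM => /eqP->.
Qed.

Lemma wdata_ex (theta : {ffun 'I_r ->
  'I_n}) mu (s : 'S_r) : wcongr n mu (wact s (resid theta)) ->
  exists c w w', wdata theta mu c w w'.
Proof.
rewrite wcongr_cres_eq -wact_cres => /eqP Es.
have [c [w' [cd cr Ew bw]]] := wdata_half mu.
(* [y] already sends [c] to the class of [- w_0 theta]; multiplying by [u] makes [w_0 y u] minimal
   without changing this. *)
pose y := wmul (w0 r) (wmul s^-1%g w').
have [u Su mu_] := minrep_ex c (wmul (w0 r) y).
exists c, (wmul y u), w'; apply/wdataE; split=> //; last first.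
  by rewrite wmulA; apply/minrepP.
rewrite wactM; move: Su; rewrite inE => /eqP->.
by rewrite /y !wactM Ew Es -[wact s^-1%g _]wactM wmulVl wact1 wact_cres.
Qed.
End Residues.

(** * Assembly: the component of theta, the sum over the stabilizer, and the constants *)

Section Main.
Variables (F : fieldType) (n r : nat) (q : F) (g : int -> F).
Hypothesis n0 : (0 < n)%N.
Hypothesis q0 : q != 0.
Hypothesis g_unit : forall j, g j != 0.
Hypothesis g_dvd : forall j, (n%:Z %| j)%Z -> g j = -1.
Hypothesis g_per : forall j, g (j + n%:Z) = g j.
Hypothesis g_ndvd : forall j, ~~ (n%:Z %| j)%Z ->
  g j * g (n%:Z - j) = (q ^+ 2)^-1.
Implicit Types (w x y u z : 'S_r) (i : 'I_r.-1) (f h : laurent F r).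
Local Notation W0 := (w0 r).
Local Notation U := (demW q).
Local Notation sp := (@subst_pow F r n).

(** The witness is the inverse [v (U_i + 1 - q^-2)] given by the quadratic relation. *)
Lemma demW_surj i f : exists h, U i h = f.
Proof.
exists (q ^+ 2 *: (U i f + (1 - q ^- 2) *: f)).
rewrite (linZ (demW_linear q i)) (linD (demW_linear q i)) demW_quad.
rewrite (linZ (demW_linear q i)).
have E : cst r q ^+ 2 * cst r (q ^- 2) = 1.
  by rewrite -cstX -cstM mulfV ?cst1 // expf_neq0.
by rewrite !cstR; transitivity (cst r q ^+ 2 * cst r (q ^- 2) * f);
  [ring | rewrite E mul1r].
Qed.

Lemma opw_demW_opinv w f : opw U w (opinv (opw U w) f) = f.
Proof.
apply: (epsilon_spec (inhabits 0) (fun h => opw U w h = f)); rewrite /opw.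
elim: (redword w) f => [|i t IH] f /=; first by exists f.
by have [h <-] := demW_surj i f; have [k <-] := IH h; exists k.
Qed.

Lemma subst_rootK f : subst_root n (sp f) = f.
Proof.
move: f; apply: linear_ypow_eq => [c f h|//|a].
  by rewrite sp_linear /subst_root linearP.
rewrite spU /subst_root lext_ypow.
have -> : wcongr n (a *+ n) 0.
  by apply/forallP => k; rewrite !ffunE ffunMnE -mulr_natr natz modzMl mod0z.
congr ypow; apply/ffunP => k; rewrite ffunE ffunMnE -mulr_natr natz mulzK //;
  lia.
Qed.

Lemma component_linear (a : weight r) : linear (component n a : laurent F r ->
  laurent F r).
Proof. by move=> c f h; rewrite /component linearP. Qed.

Lemma component_window (a b eta : weight r) f : window n a -> window n eta ->
  component n (a - b) (ypow (- b) * (sp f * ypow eta)) =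
  (eta == a)%:R * (ypow (- b) * (sp f * ypow eta)).
Proof.
move=> Ha He; move: f; apply: linear_ypow_eq => [c f h|c f h|d].
- by rewrite sp_linear mulrDl mulrDr -scalerAl -scalerAr component_linear.
- by rewrite sp_linear !cstR; ring.
rewrite spU -!ypowD /component lext_ypow.
have -> : wcongr n (- b + (d *+ n + eta)) (a - b) = (eta == a).
  apply/forallP/eqP => [E|-> k]; last first.
    rewrite !ffunE ffunMnE eqz_mod_dvd -mulr_natr natz.
    by apply/dvdzP; exists (d k); ring.
  rewrite -(wres_winE (r := r) 0 Ha) -(wres_winE d He) mul0rn add0r.
  apply/ffunP => k; rewrite !ffunE; apply/eqP; rewrite eqz_mod_dvd.
  have := E k; rewrite !ffunE eqz_mod_dvd; congr (_ %| _)%Z; ring.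
by case: eqP => _; rewrite ?mul1r ?mul0r.
Qed.

(** With [U_{w'} P = y^(floor (mu / n))], the transfer of [(U_{w'} P) . delta_{w'}] is [h(w') y^mu],
    so the symmetrized regular element transfers to the spherical function. The component keeps the
    [x] with [x (n - c) = theta]. *)
Lemma sphericalW_expand (theta : {ffun 'I_r ->
  'I_n}) (mu c : weight r) (w' : 'S_r) (P : laurent F r) :
  decreasing c -> in_range n c -> wact w' c = cres n mu ->
  hop U w' P = ypow (wfloor n mu) ->
  ypow (rho r - resid theta) * sphericalW q g theta mu =
  sp (\sum_(x | wact x c == cres n (resid theta))
        (hfac q g c x / hfac q g c w') *:
        hsym q (hact (hop U w' P) (hdelta F w')) x).
Proof.
move=> cd cr Ew EP.
have h0 : hfac q g c w' != 0 by apply: hfac_neq0.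
pose p := hact (hop U w' P) (hdelta F w').
have Emu : transfer n q g c p = hfac q g c w' *: ypow mu.
  rewrite transfer_act EP wact_cwin Ew cwin_cres; congr (_ *: _).
  by rewrite -ypow_div.
have Emu' : ypow mu = (hfac q g c w')^-1 *: transfer n q g c p.
  by rewrite Emu scalerA mulVf // scale1r.
rewrite /sphericalW.
have -> : \sum_w iota_y (opw (metaDemW n q g) w (iota_y (ypow (mu - rho r)))) =
    (hfac q g c w')^-1 *: (ypow (- rho r) * transfer n q g c (hsym q p)).
  have -> : ypow (- rho r) * transfer n q g c (hsym q p) =
      \sum_w ypow (- rho r) * hop (kop n q g) w (transfer n q g c p).
    by rewrite -mulr_sumr sum_hop_transfer.
  rewrite scaler_sumr; apply: eq_bigr => w _; rewrite iota_opw_metaDemW //.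
  have lK := @hop_linear r F (laurent F r) (kop n q g) (kop_linear n q g) w.
  by rewrite -ypowD addrC subrK Emu' (linZ lK) scalerAr.
rewrite (linZ (component_linear _)) /transfer mulr_sumr (lin_sum
  (component_linear _)).
rewrite (lin_sum (sp_linear n)) -scalerAr !mulr_sumr scaler_sumr
  [RHS]big_mkcond.
apply: eq_bigr => x _; rewrite -scalerAr (linZ (component_linear _)).
have Hw : window n (wact x (cwin n c)) by apply/window_act/cwin_window.
rewrite component_window ?resid_window //.
have -> : (wact x (cwin n c) == resid theta) = (wact x c == cres n (resid
  theta)).
  rewrite -(wres_window_id (resid_window theta)) -cwin_cres wact_cwin.
  by rewrite (inj_eq (@cwin_inj _ _)) cwin_cres wres_window_id ?resid_window.
have [E|_] := eqVneq; last by rewrite mul0r !(scaler0, mulr0).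
have Ex : wact x (cwin n c) = resid theta.
  by rewrite wact_cwin E cwin_cres wres_window_id ?resid_window.
rewrite mul1r Ex (linZ (sp_linear n)) -scalerAr scalerA [_^-1 * _]mulrC.
congr (_ *: _); rewrite -/p; set Z := sp _.
transitivity (ypow (rho r - resid theta) * ypow (- rho r) * ypow (resid theta)
  * Z).
  by ring.
by rewrite -!ypowD addrAC subrK subrr ypow0 mul1r.
Qed.

Lemma demW_sum_stab (c : weight r) w P : decreasing c -> w \in wstab c ->
  hop U w (\sum_(u in wstab c) hop U u P) =
  (q ^- 2) ^+ len w *: \sum_(u in wstab c) hop U u P.
Proof.
move=> cd; move: w; apply: perm_lind => [|i w nd IH Sw].
  by rewrite hop1 len1 scale1r.
have d : ldesc i (wmul (srefl i) w) by rewrite ldesc_srefl.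
have Ji : i \in Jset c by exact: wstab_ldesc Sw d.
have Sw' : w \in wstab c by rewrite -(wmul_sreflK i w) wstab_srefl.
rewrite (hop_srefl (demW_far q) (demW_near q)) // IH // (linZ (demW_linear q
  i)).
have -> : U i (\sum_(u in wstab c) hop U u P) = q ^- 2 *: \sum_(u in wstab c)
  hop U u P.
  apply: (hop_sum_left (demW_far q) (demW_near q) (demW_linear q) (demW_quad
    q)).
  by move=> u; apply: wstabM; apply: Jset_stab.
by rewrite scalerA (len_srefl nd) [(q ^- 2) ^+ _.+1]exprSr.
Qed.

Lemma hop_demW_stab (c : weight r) x P : decreasing c -> blockinc c x ->
  hop U x (\sum_(u in wstab c) hop U u P) = \sum_(u in wstab c) hop U (wmul x
    u) P.
Proof.
move=> cd bx; rewrite (lin_sum (hop_linear (demW_linear q) x)).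
apply: eq_bigr => u Su; rewrite (hop_mul (demW_far q) (demW_near q)) //.
exact: (len_stab cd bx Su).
Qed.

(** Here only [w_up] acts on the sum over the stabilizer, so the constant is [C] without the factor
    coming from [w_lo]. *)
Lemma main_identity (theta : {ffun 'I_r -> 'I_n}) (mu c : weight r)
    (w w' w_up w_lo : 'S_r) (P : laurent F r) :
  wdata theta mu c w w' ->
  w = wmul w_up w_lo -> w_up \in minrep (wstab c) -> w_lo \in wstab c ->
  hop U w' P = ypow (wfloor n mu) ->
  lact W0 (subst_root n (ypow (rho r - resid theta) * sphericalW q g theta
    mu)) =
  ((-1) ^+ len W0 * q ^ ((len w)%:Z - (len w')%:Z + (len W0)%:Z)
    * hfac q g c (wmul W0 w) / hfac q g c w') *:
  hop U w_up (\sum_(u in wstab c) hop U u P).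
Proof.
move=> /wdataE-/(_ n0)[[cd cr] E1 E2 b1 b2] Ew /(minrepP cd) bup Slo EP.
rewrite (sphericalW_expand theta cd cr E1 EP) subst_rootK (lin_sum
  (lact_linear W0)).
rewrite (hop_demW_stab P cd bup).
(* In terms of [x = w_0 w u], the condition selecting the class of [theta] becomes [u c = c]. *)
have inj1 : injective (fun u : 'S_r => wmul W0 (wmul w u)).
  by move=> u u' /wmul_inj/wmul_inj.
rewrite (reindex_inj inj1) /=.
(* [w] and [w_up] span the same coset of the stabilizer. *)
have -> : \sum_(u in wstab c) hop U (wmul w_up u) P = \sum_(u in wstab c) hop
  U (wmul w u) P.
  rewrite (reindex_inj (@wmul_inj _ w_lo)) /=.
  rewrite (eq_bigl (mem (wstab c))); last first.
    move=> u; apply/idP/idP => Su; last exact: wstabM.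
    by have := wstabM (wstabV Slo) Su; rewrite wmulA wmulVl wmul1l.
  by apply: eq_bigr => u _; rewrite wmulA Ew.
rewrite scaler_sumr; apply: eq_big => u.
  rewrite inE !wactM -(inj_eq (@wact_inj _ W0)) -wactM.
  rewrite -{1}[W0]w0_inv wmulVl wact1 wact_cres.
  by rewrite -E2 (inj_eq (@wact_inj _ w)).
rewrite !wactM => /eqP Eu.
have Su : u \in wstab c.
  rewrite inE -(inj_eq (@wact_inj _ w)) -(inj_eq (@wact_inj _ W0)) Eu E2.
  by rewrite -wact_cres -wactM -{1}[W0]w0_inv wmulVl wact1.
rewrite hsym_hop_coef // !lactZ lact_w0K scalerA.
congr (_ *: _).
have g00 : g 0 = -1 by apply: g_dvd; rewrite dvdz0.
rewrite wmulA (hfac_stab q cd g00 b2 Su).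
(* [w] is longest in its coset, so multiplication by [u] lowers its length by [l(u)]; the factor
   [q^l(u)] from [hfac_stab] compensates. *)
have El : (len (wmul w u) + len u)%N = len w.
  have := len_stab cd b2 Su; have := len_w0_mul w; have :=
    len_w0_mul (wmul w u).
  by rewrite wmulA; lia.
have q_len : q ^+ len (wmul w u) * q ^+ len u = q ^+ len w.
  by rewrite -exprD El.
have -> : q ^ ((len w)%:Z - (len w')%:Z + (len W0)%:Z) =
    q ^+ len (wmul w u) * q ^+ len u * q ^- len w' * q ^+ len W0.
  by rewrite q_len !expfzDr // -!exprnP -exprnN.
rewrite [(- q) ^+ _]exprNn.
move: (hfac q g c (wmul W0 w)) (hfac q g c w')^-1 (q ^+ len (wmul w u)).
move: (q ^+ len u) (q ^- len w') (q ^+ len W0) ((-1) ^+ len W0).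
by move=> *; ring.
Qed.
End Main.

Theorem theorem1p1 (F : fieldType) (n r : nat) (hn : (1 <= n)%N) (hr : (2 <= r)%N)
    (v q : F) (hv : v != 0) (hq : q ^+ 2 = v)
    (g : int -> F) (g_unit : forall j, g j != 0)
    (g_dvd : forall j, (n%:Z %| j)%Z -> g j = -1)
    (g_per : forall j, g (j + n%:Z) = g j)
    (g_ndvd : forall j, ~~ (n%:Z %| j)%Z -> g j * g (n%:Z - j) = v^-1)
    (theta : {ffun 'I_r -> 'I_n}) (mu : weight r)
    (hmu : decreasing (mu - rho r)) :
  let phi := ypow (rho r - resid theta) * sphericalW q g theta mu in
  let w0 := longest [set: 'S_r] in
  let mu_perm := exists s : 'S_r, wcongr n mu (wact s (resid theta)) in
  [/\ exists p, phi = subst_pow n p,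
      ~ mu_perm -> phi = 0
    & mu_perm ->
      (exists! t : weight r * 'S_r * 'S_r, wdata theta mu t.1.1 t.1.2 t.2) /\
      forall (c : weight r) (w w' w_up w_lo : 'S_r),
        wdata theta mu c w w' ->
        w = wmul w_up w_lo -> w_up \in minrep (wstab c) -> w_lo \in wstab c ->
        let lam := wfloor n mu - rho r in
        let C := (-1) ^+ len w0
                 * q ^ ((len w)%:Z - (len w')%:Z + (len w0)%:Z
                        + 2 * (len (longest (wstab c)))%:Z)
                 * hfac q g c (wmul w0 w) / hfac q g c w' in
        let C' := v ^ ((len w')%:Z - (len w_lo)%:Z) * C in
        let rhs1 := C *: opw (demW q) w
                      (\sum_(u in wstab c)
                         opw (demW q) u
                           (opinv (opw (demW q) w') (ypow (lam + rho r)))) in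
        let rhs2 := C' *: (ypow (rho r) *
                           parahoricW q^-1 (Jset c) w_up w' lam) in
        lact w0 (subst_root n phi) = rhs1 /\ rhs1 = rhs2].
Proof.
move=> phi W0 mu_perm.
have q0 : q != 0 by apply: contra hv => /eqP q0; rewrite -hq q0 expr0n.
rewrite -hq in g_ndvd *.
(* The first two claims concern arbitrary [mu], so the half of the data depending on [mu] has to
   serve. *)
have [c [w' [cd cr Ew' bw']]] := wdata_half hn mu.
have Ephi := sphericalW_expand hn q0 g_unit g_dvd g_per g_ndvd theta cd cr Ew'
  (opw_demW_opinv q0 w' (ypow (wfloor n mu))).
split.
- by eexists; exact: Ephi.
- move=> nperm; rewrite /phi Ephi big1 ?(lin0 (sp_linear n)) // => x /eqP Ex.
  case: nperm; exists (wmul w' x^-1%g); rewrite wcongr_cres_eq -wact_cres -Ex.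
  by rewrite wactM -[wact x^-1%g _]wactM wmulVl wact1 Ew'.
move=> [s Es]; split.
  have [c1 [w1 [w1' D]]] := wdata_ex hn Es.
  exists (c1, w1, w1'); split=> [//|[[c2 w2] w2'] /= D2].
  exact: (wdata_unique hn D D2).
move=> {cd cr Ew' bw' Ephi} {}c w {}w' w_up w_lo D Ew mup Slo lam C C' rhs1 rhs2.
pose P := opinv (opw (demW q) w') (ypow (lam + rho r)).
have EP : hop (demW q) w' P = ypow (wfloor n mu).
  by rewrite /P -[hop _ _ _]/(opw _ _ _) opw_demW_opinv // subrK.
have [[cd cr] _ _ bw' bw] := (wdataE hn theta mu c w w').1 D.
have bup := (minrepP cd w_up).1 mup.
have Elo : len w_lo = len (longest (wstab c)).
  exact: (len_longest_stab cd bw Ew bup Slo).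
set X := hop (demW q) w_up (\sum_(u in wstab c) hop (demW q) u P).
(* Lengths add in [w = w_up w_lo], and [w_lo] acts on the sum over the stabilizer by
   [v^(-l(w_lo))]. *)
have E1 : rhs1 = (C * (q ^- 2) ^+ len w_lo) *: X.
  rewrite /rhs1 -/P -[opw _ w _]/(hop (demW q) w _) Ew.
  rewrite (hop_mul (demW_far q) (demW_near q)); last exact: (len_stab cd bup Slo).
  rewrite -/(hop _ _ _) (demW_sum_stab q P cd Slo).
  by rewrite (linZ (hop_linear (demW_linear q) w_up)) scalerA.
(* [parahoricW] is taken at the square root [q^-1] and inverts it once more, so its operators are
   again [demW q], while its prefactor is [v^(-l(w'))]. *)
have E2 : rhs2 = (C' * (q ^- 2) ^+ len w') *: X.
  rewrite /rhs2 /parahoricW invrK -/P wpara_Jset //.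
  rewrite -scalerAr scalerA mulrA -ypowD subrr ypow0 mul1r [q^-1 ^+ 2]exprVn.
  by rewrite /X (hop_demW_stab q P cd bup).
have qlen k : (q ^- 2) ^+ k = q ^ (- 2 * k%:Z).
  by rewrite exprVn -exprM mulNr -PoszM -exprnN.
split.
  rewrite E1 /phi (main_identity hn q0 g_unit g_dvd g_per g_ndvd D Ew mup Slo EP).
  congr (_ *: _); rewrite /C -Elo qlen.
  set e := (_ + _ : int); rewrite -/W0 -/(w0 r).
  have -> : q ^ e = q ^ (e + 2 * (len w_lo)%:Z) * q ^ (- 2 * (len w_lo)%:Z).
    by rewrite -expfzDr // mulNr addrK.
  move: (q ^ _) (q ^ _) (hfac _ _ _ _) (hfac q g c w')^-1 ((-1) ^+ _) => *; ring.
rewrite E1 E2; congr (_ *: _); rewrite !qlen /C'.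
have -> : (q ^+ 2) ^ ((len w')%:Z - (len w_lo)%:Z) =
    q ^ (2 * ((len w')%:Z - (len w_lo)%:Z)) by rewrite exprnP exprz_exp.
have -> : q ^ (- 2 * (len w_lo)%:Z) =
    q ^ (2 * ((len w')%:Z - (len w_lo)%:Z)) * q ^ (- 2 * (len w')%:Z).
  by rewrite -expfzDr //; congr (q ^ _); ring.
by rewrite mulrCA mulrA.
Qed.
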